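(* Let $1<p<\infty$, and suppose that $f\in H^p$ satisfies $f(0)\neq 0$. If $\lambda = q_{0,p}[f]$, then for any constant $c\in\mathbb{C}$ we have \[ |\lambda|^s \geq \frac{1-\|cf-1\|_p^s}{K_2\big(\|f-f(0)\|_p^s+\|f\|_p^s\big)}, \] where $s$ and $K_2$ are the upper Pythagorean parameters.
   Context: $H^p$ denotes the classical Hardy space of holomorphic functions on the open unit disk $\mathbb{D}$, with norm $\|f\|_p = \left(\sup_{0\le \rho<1}\frac{1}{2\pi}\int_0^{2\pi}|f(\rho e^{i\theta})|^p\,d\theta\right)^{1/p}$. For an integer $n\ge 0$ let $\mathcal{P}_n$ be the set of complex polynomials of degree at most $n$. For $1<p<\infty$ and $f\in H^p$, not identically zero, the $n$-th optimal polynomial approximant (OPA) to $1/f$ in $H^p$, denoted $q_{n,p}[f]$, is the unique polynomial $q\in\mathcal{P}_n$ minimizing $\|1-qf\|_p$ over $\mathcal{P}_n$; in particular $q_{0,p}[f]$ is a complex constant. The upper Pythagorean parameters are: $s=p$, $K_2=\frac{1}{2^{p-1}-1}$ if $1<p\le 2$; and $s=2$, $K_2=p-1$ if $2\le p<\infty$. (They are the parameters for which $\|x+y\|_p^s\le \|x\|_p^s+K_2\|y\|_p^s$ whenever $x\perp_p y$ in $L^p$, where $x\perp_p y$ means $\|x+\beta y\|_p\ge\|x\|_p$ for all scalars $\beta$.) *)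

(* Defs.v *)
From Stdlib Require Import Reals.
From Coquelicot Require Import Coquelicot.
Open Scope R_scope.

(* Real power x ^ a of x >= 0 for exponents a > 0. Stdlib's Rpower is
   exp (a * ln x) with ln 0 = 0, so that Rpower 0 a = 1 and not 0. *)
Definition rpow (x a : R) : R :=
  if Req_EM_T x 0 then 0 else Rpower x a.

Definition polar (rho t : R) : C := (rho * cos t, rho * sin t).

Definition holomorphic_on_disk (f : C -> C) : Prop :=
  forall z : C, Cmod z < 1 ->
    ex_derive (K := C_AbsRing) (V := C_NormedModule) f z.

Definition hardy_mean (p : R) (f : C -> C) (rho : R) : R :=
  / (2 * PI) * RInt (fun t => rpow (Cmod (f (polar rho t))) p) 0 (2 * PI).

Definition hardy_sup (p : R) (f : C -> C) : Rbar :=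
  Lub_Rbar (fun m => exists rho, 0 <= rho < 1 /\ m = hardy_mean p f rho).

(* Elements of H^p are represented by total functions C -> C, of which only
   the restriction to the open unit disk matters. *)
Definition Hp (p : R) (f : C -> C) : Prop :=
  holomorphic_on_disk f /\ is_finite (hardy_sup p f).

(* Meaningful for f in H^p only: real sends an infinite supremum to 0. *)
Definition hardy_norm (p : R) (f : C -> C) : R :=
  rpow (real (hardy_sup p f)) (/ p).

Definition poly_deg_le (n : nat) (q : C -> C) : Prop :=
  exists a : nat -> C, forall z : C,
    q z = sum_n (fun k => Cmult (a k) (Cpow z k)) n.

Definition is_opa (n : nat) (p : R) (f q : C -> C) : Prop :=
  poly_deg_le n q /\
  forall r : C -> C, poly_deg_le n r ->
    hardy_norm p (fun z => (1 - q z * f z)%C) <=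
    hardy_norm p (fun z => (1 - r z * f z)%C).

Definition upper_s (p : R) : R := if Rle_dec p 2 then p else 2.

Definition upper_K2 (p : R) : R :=
  if Rle_dec p 2 then 1 / (Rpower 2 (p - 1) - 1) else p - 1.

(* Main.v *)
Require Import Defs.
From Stdlib Require Import Reals Lra Lia Classical ClassicalEpsilon.
From Stdlib Require Import FunctionalExtensionality.
From Coquelicot Require Import Coquelicot.
Open Scope R_scope.

(** Write [s], [K2] for the upper Pythagorean parameters and [|| . ||] for the
    Hardy norm. The constant [lambda] makes [|| 1 - lambda f ||] least among all
    constants, so the Pythagorean inequality for [1 = (1 - lambda f) + lambda f]
    gives [1 <= || 1 - lambda f || ^ s + K2 |lambda| ^ s || f || ^ s]
    ([pythagorean_opa]). Again by minimality [|| 1 - lambda f || <= || c f - 1 ||],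
    and [|| f || ^ s <= || f - f(0) || ^ s + || f || ^ s]; division gives the
    theorem.

    The Pythagorean inequality comes from the upper weak parallelogram law
    [|| F + G || ^ s + || F - G || ^ s <= 2 (|| F || ^ s + K || G || ^ s)], where
    [K] is [1] for [p <= 2] and [p - 1] for [2 <= p] ([weak_parallelogram]).
    Along the line from [1 - lambda f] to [1] it bounds the second differences of
    [|| . || ^ s]; repeated halving of the increment, starting from the minimum,
    turns this into the constant [K2 = K / (2 ^ (s - 1) - 1)]
    ([smooth_minimum_bound]).

    On a fixed circle the law is a fact about [L ^ p]. For [p <= 2] it holds
    pointwise and is integrated. For [2 <= p] the pointwise statement is the
    two-point inequality
    [(|w + e| ^ p + |w - e| ^ p) / 2 <= (|w| ^ 2 + (p - 1) |e| ^ 2) ^ (p / 2)],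
    which a second derivative bound proves, and Minkowski's inequality in
    [L ^ (p / 2)] integrates it ([weak_parallelogram_mean]).

    The Hardy norm is a supremum over circles, and the law has two norms on the
    side to be bounded. Both are approached on the same circle, because the means
    increase with the radius ([circle_mean_nondecreasing]). This follows from
    complex differentiability alone: Goursat's argument on rectangles, in
    logarithmic coordinates, gives the mean value property ([mean_value_Re]);
    the tangent to [x ^ p] makes [|F| ^ p] subharmonic; the maximum principle,
    applied to Riemann sums of the circle means as functions of the position of
    their sample points, compares two circles. *)

(** * Real powers of nonnegative numbers *)

Lemma rpow_0 a : rpow 0 a = 0.
Proof. unfold rpow; destruct (Req_EM_T 0 0); [reflexivity|lra]. Qed.

Lemma rpow_Rpower x a : 0 < x -> rpow x a = Rpower x a.
Proof. intros Hx; unfold rpow; destruct (Req_EM_T x 0); [lra|reflexivity]. Qed.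

Lemma Rpower_pos x a : 0 < Rpower x a.
Proof. apply exp_pos. Qed.

Lemma rpow_pos x a : 0 < x -> 0 < rpow x a.
Proof. intros Hx; rewrite rpow_Rpower by exact Hx; apply Rpower_pos. Qed.

Lemma rpow_nonneg x a : 0 <= rpow x a.
Proof. unfold rpow; destruct (Req_EM_T x 0); [lra|left; apply Rpower_pos]. Qed.

Lemma rpow_mult x y a : 0 <= x -> 0 <= y ->
  rpow (x * y) a = rpow x a * rpow y a.
Proof.
intros [Hx|<-] [Hy|<-]; rewrite ?Rmult_0_l, ?Rmult_0_r, ?rpow_0, ?Rmult_0_l, ?Rmult_0_r;
  try reflexivity.
rewrite !rpow_Rpower by (try apply Rmult_lt_0_compat; assumption).
symmetry; apply Rpower_mult_distr; assumption.
Qed.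

Lemma rpow_rpow x a b : 0 <= x -> rpow (rpow x a) b = rpow x (a * b).
Proof.
intros [Hx|<-]; [|rewrite !rpow_0; reflexivity].
rewrite (rpow_Rpower x a), (rpow_Rpower x (a * b)), rpow_Rpower
  by (assumption || apply Rpower_pos).
apply Rpower_mult.
Qed.

Lemma rpow_1 x : 0 <= x -> rpow x 1 = x.
Proof.
intros [Hx|<-]; [|apply rpow_0].
rewrite rpow_Rpower by exact Hx; apply Rpower_1; exact Hx.
Qed.

Lemma rpow_2 x : 0 <= x -> rpow x 2 = x ^ 2.
Proof.
intros [Hx|<-]; [|rewrite rpow_0; ring].
rewrite rpow_Rpower by exact Hx.
replace 2 with (INR 2) by (simpl; ring); apply Rpower_pow; exact Hx.
Qed.

Lemma rpow_1_l a : rpow 1 a = 1.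
Proof.
rewrite rpow_Rpower by lra; unfold Rpower; rewrite ln_1, Rmult_0_r; apply exp_0.
Qed.

Lemma rpow_le x y a : 0 <= a -> 0 <= x <= y -> rpow x a <= rpow y a.
Proof.
intros Ha [[Hx|<-] Hxy]; [|rewrite rpow_0; apply rpow_nonneg].
rewrite !rpow_Rpower by lra; apply Rle_Rpower_l; lra.
Qed.

Lemma rpow_inv_r x a : a <> 0 -> 0 <= x -> rpow (rpow x a) (/ a) = x.
Proof.
intros Ha Hx; rewrite rpow_rpow by exact Hx.
rewrite Rinv_r by exact Ha; apply rpow_1; exact Hx.
Qed.

Lemma rpow_inv_l x a : a <> 0 -> 0 <= x -> rpow (rpow x (/ a)) a = x.
Proof.
intros Ha Hx; rewrite rpow_rpow by exact Hx.
rewrite Rinv_l by exact Ha; apply rpow_1; exact Hx.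
Qed.

(** The absolute value avoids the negative half-line, on which [rpow] jumps to
    the value [1] of [Rpower]. *)
Lemma rpow_abs_continuous a : 0 < a ->
  forall x, continuous (fun t => rpow (Rabs t) a) x.
Proof.
intros Ha x; destruct (Req_dec x 0) as [->|Hx].
- apply continuity_pt_filterlim; intros eps Heps.
  exists (rpow eps (/ a)); split; [apply rpow_pos; exact Heps|].
  intros t [_ Ht]; simpl in *; unfold Rdist in *.
  rewrite Rabs_R0, rpow_0, Rminus_0_r, Rabs_pos_eq by apply rpow_nonneg.
  rewrite Rminus_0_r in Ht.
  apply Rnot_le_lt; intros Hle.
  assert (Hinv : 0 <= / a) by (left; apply Rinv_0_lt_compat; exact Ha).
  assert (H := rpow_le _ _ (/ a) Hinv (conj (Rlt_le _ _ Heps) Hle)).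
  rewrite rpow_inv_r in H; [lra|lra|apply Rabs_pos].
- apply continuous_ext_loc with (fun t => Rpower (Rabs t) a).
  + assert (Hpos : 0 < Rabs x) by (apply Rabs_pos_lt; exact Hx).
    exists (mkposreal _ Hpos); intros t Ht.
    change (Rabs (t - x) < Rabs x) in Ht.
    symmetry; apply rpow_Rpower, Rabs_pos_lt; intros ->.
    rewrite Rminus_0_l, Rabs_Ropp in Ht; lra.
  + apply continuous_comp with (f := Rabs) (g := fun t => Rpower t a).
    * apply continuous_Rabs.
    * apply (ex_derive_continuous (K := R_AbsRing) (V := R_NormedModule)).
      eexists; apply is_derive_Reals.
      apply derivable_pt_lim_power, Rabs_pos_lt; exact Hx.
Qed.

(** Weighted arithmetic-geometric mean of [1] and [v = 1 + a (u - 1)], through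
    the tangent to the exponential. *)
Lemma bernoulli u a : 1 <= a -> 0 <= u -> 1 + a * (u - 1) <= rpow u a.
Proof.
intros Ha Hu.
destruct (Rle_dec (1 + a * (u - 1)) 0) as [Hneg|Hv].
{ apply Rle_trans with (1 := Hneg), rpow_nonneg. }
apply Rnot_le_lt in Hv; set (v := 1 + a * (u - 1)) in *.
assert (Hu0 : 0 < u) by (unfold v in Hv; nra).
set (L := ln v / a).
assert (H1 : 1 <= u * exp (- L)).
{ assert (E1 := exp_ineq1_le (- L)); assert (E2 := exp_ineq1_le (ln v - L)).
  unfold Rminus in E2; rewrite exp_plus, exp_ln in E2 by exact Hv.
  assert (Hainv : 0 < / a <= 1).
  { split; [apply Rinv_0_lt_compat; lra|].
    rewrite <- Rinv_1; apply Rinv_le_contravar; lra. }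
  replace u with ((1 - / a) * 1 + / a * v) by (unfold v; field; lra).
  rewrite Rmult_plus_distr_r, Rmult_1_r, Rmult_assoc.
  assert (HL : / a * ln v = L) by (unfold L, Rdiv; ring).
  nra. }
assert (H2 : L <= ln u).
{ rewrite <- (ln_exp L); apply ln_le; [apply exp_pos|].
  rewrite exp_Ropp in H1.
  apply (Rmult_le_compat_r (exp L)) in H1; [|left; apply exp_pos].
  rewrite Rmult_assoc, Rinv_l in H1 by apply Rgt_not_eq, exp_pos; lra. }
rewrite rpow_Rpower by exact Hu0; unfold Rpower.
rewrite <- (exp_ln v) by exact Hv.
replace (ln v) with (a * L) by (unfold L; field; lra).
assert (H3 : a * L <= a * ln u) by (apply Rmult_le_compat_l; lra).
destruct H3 as [H3|H3]; [left; apply exp_increasing; exact H3|rewrite H3; lra].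
Qed.

Lemma rpow_tangent x y a : 1 <= a -> 0 <= x -> 0 < y ->
  rpow y a + a * (rpow y a / y) * (x - y) <= rpow x a.
Proof.
intros Ha Hx Hy.
replace x with (y * (x / y)) at 2 by (field; lra).
assert (Hxy : 0 <= x / y) by (apply Rdiv_le_0_compat; assumption).
rewrite rpow_mult by lra.
assert (Hb := bernoulli (x / y) a Ha Hxy).
apply (Rmult_le_compat_l (rpow y a)) in Hb; [|apply rpow_nonneg].
apply Rle_trans with (2 := Hb); right; field; lra.
Qed.

Lemma rpow_convex k x y a : 1 <= a -> 0 <= k <= 1 -> 0 <= x -> 0 <= y ->
  rpow (k * x + (1 - k) * y) a <= k * rpow x a + (1 - k) * rpow y a.
Proof.
intros Ha Hk Hx Hy.
assert (Hm : 0 <= k * x + (1 - k) * y) by nra.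
set (m := k * x + (1 - k) * y) in *.
destruct Hm as [Hm|<-].
- assert (T1 := rpow_tangent x m a Ha Hx Hm).
  assert (T2 := rpow_tangent y m a Ha Hy Hm).
  apply (Rmult_le_compat_l k) in T1; [|lra].
  apply (Rmult_le_compat_l (1 - k)) in T2; [|lra].
  apply Rle_trans with (2 := Rplus_le_compat _ _ _ _ T1 T2).
  right; unfold m; ring.
- rewrite rpow_0; generalize (rpow_nonneg x a) (rpow_nonneg y a); nra.
Qed.

Lemma rpow_midpoint_convex x y a : 1 <= a -> 0 <= x -> 0 <= y ->
  rpow ((x + y) / 2) a <= (rpow x a + rpow y a) / 2.
Proof.
intros Ha Hx Hy.
generalize (rpow_convex (/ 2) x y a Ha ltac:(lra) Hx Hy); intros H.
replace ((x + y) / 2) with (/ 2 * x + (1 - / 2) * y) by field; lra.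
Qed.

Lemma rpow_midpoint_concave x y a : 0 < a <= 1 -> 0 <= x -> 0 <= y ->
  (rpow x a + rpow y a) / 2 <= rpow ((x + y) / 2) a.
Proof.
intros Ha Hx Hy.
assert (Hinv : 1 <= / a) by (rewrite <- Rinv_1; apply Rinv_le_contravar; lra).
assert (H := rpow_midpoint_convex _ _ _ Hinv (rpow_nonneg x a) (rpow_nonneg y a)).
rewrite !rpow_inv_r in H by lra.
rewrite <- (rpow_inv_l ((rpow x a + rpow y a) / 2) a).
- apply rpow_le; [lra|split; [apply rpow_nonneg|exact H]].
- lra.
- generalize (rpow_nonneg x a) (rpow_nonneg y a); lra.
Qed.

Lemma rpow_subadditive x y a : 0 < a <= 1 -> 0 <= x -> 0 <= y ->
  rpow (x + y) a <= rpow x a + rpow y a.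
Proof.
intros Ha Hx Hy.
destruct (Req_dec (x + y) 0) as [E|E].
{ rewrite E, rpow_0; generalize (rpow_nonneg x a) (rpow_nonneg y a); lra. }
assert (Hfrac : forall t, 0 <= t <= 1 -> t <= rpow t a).
{ intros t [[Ht|<-] Ht1]; [|rewrite rpow_0; lra].
  rewrite rpow_Rpower by exact Ht.
  rewrite <- (Rpower_1 t Ht) at 1; unfold Rpower.
  assert (Hln : ln t <= 0) by (rewrite <- ln_1; apply ln_le; assumption).
  destruct (Rle_lt_or_eq_dec (1 * ln t) (a * ln t)) as [H|H].
  - generalize (Rmult_le_pos (1 - a) (- ln t)); lra.
  - left; apply exp_increasing; exact H.
  - rewrite H; lra. }
assert (Hs : 0 < x + y) by lra.
assert (Hqx : 0 <= x / (x + y)) by (apply Rdiv_le_0_compat; lra).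
assert (Hqy : 0 <= y / (x + y)) by (apply Rdiv_le_0_compat; lra).
assert (Hsum : x / (x + y) + y / (x + y) = 1) by (field; lra).
assert (Hscale : forall t, 0 <= t / (x + y) ->
  rpow t a = rpow (x + y) a * rpow (t / (x + y)) a).
{ intros t Ht; rewrite <- rpow_mult by lra; f_equal; field; lra. }
rewrite (Hscale x), (Hscale y) by assumption.
assert (Fx : x / (x + y) <= rpow (x / (x + y)) a) by (apply Hfrac; lra).
assert (Fy : y / (x + y) <= rpow (y / (x + y)) a) by (apply Hfrac; lra).
generalize (rpow_nonneg (x + y) a); nra.
Qed.

(** * The two-point inequality *)

Lemma nondecreasing_of_derive (g dg : R -> R) t : 0 <= t ->
  (forall x, 0 <= x <= t -> is_derive g x (dg x) /\ 0 <= dg x) -> g 0 <= g t.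
Proof.
intros Ht H.
destruct (MVT_gen g 0 t dg) as [c [Hc E]].
- intros x Hx; rewrite Rmin_left, Rmax_right in Hx by exact Ht; apply H; lra.
- intros x Hx; rewrite Rmin_left, Rmax_right in Hx by exact Ht.
  apply continuity_pt_filterlim,
    (ex_derive_continuous (K := R_AbsRing) (V := R_NormedModule)).
  exists (dg x); apply H; lra.
- rewrite Rmin_left, Rmax_right in Hc by exact Ht.
  generalize (proj2 (H c Hc)); nra.
Qed.

Lemma is_derive_Rpower (g : R -> R) a x dg : 0 < g x -> is_derive g x dg ->
  is_derive (fun t => Rpower (g t) a) x (a * Rpower (g x) (a - 1) * dg).
Proof.
intros Hg Hd; rewrite Rmult_comm.
apply (is_derive_comp (K := R_AbsRing) (V := R_NormedModule) (fun y => Rpower y a) g).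
- apply is_derive_Reals, derivable_pt_lim_power; exact Hg.
- exact Hd.
Qed.

(** The function [psi ^ (2 / p)], with [psi] the mean of the [p]-th powers of
    [1 + t] and [1 - t], has value [1] and derivative [0] at [0], and its second
    derivative is at most [2 (p - 1)]: in the product rule the term with
    [psi' ^ 2] is nonpositive, and Jensen's inequality bounds [psi'']. The two
    monotonicity arguments integrate this bound twice. *)
Lemma two_point_unit p t : 2 <= p -> 0 <= t < 1 ->
  (Rpower (1 + t) p + Rpower (1 - t) p) / 2
    <= Rpower (1 + (p - 1) * t ^ 2) (p / 2).
Proof.
intros Hp Ht.
set (psi := fun s => (Rpower (1 + s) p + Rpower (1 - s) p) / 2).
set (dif := fun s => Rpower (1 + s) (p - 1) - Rpower (1 - s) (p - 1)).
assert (Hpsi : forall s, 0 < psi s).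
{ intros s; unfold psi; generalize (Rpower_pos (1 + s) p) (Rpower_pos (1 - s) p); lra. }
assert (D1 : forall a s, 0 <= s < 1 ->
  is_derive (fun r => Rpower (1 + r) a) s (a * Rpower (1 + s) (a - 1))).
{ intros a s Hs; rewrite <- (Rmult_1_r (a * _)).
  apply is_derive_Rpower; [lra|auto_derive; [exact I|ring]]. }
assert (D2 : forall a s, 0 <= s < 1 ->
  is_derive (fun r => Rpower (1 - r) a) s (- (a * Rpower (1 - s) (a - 1)))).
{ intros a s Hs; replace (- (a * Rpower (1 - s) (a - 1)))
    with (a * Rpower (1 - s) (a - 1) * - 1) by ring.
  apply is_derive_Rpower; [lra|auto_derive; [exact I|ring]]. }
assert (Dpsi : forall s, 0 <= s < 1 -> is_derive psi s (p / 2 * dif s)).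
{ intros s Hs; unfold psi.
  apply is_derive_ext with (fun r => / 2 * (Rpower (1 + r) p + Rpower (1 - r) p)).
  { intros r; unfold Rdiv; apply Rmult_comm. }
  replace (p / 2 * dif s) with (/ 2 * (p * Rpower (1 + s) (p - 1)
    + - (p * Rpower (1 - s) (p - 1)))) by (unfold dif; field).
  apply (is_derive_scal (fun r => Rpower (1 + r) p + Rpower (1 - r) p)).
  apply (is_derive_plus (K := R_AbsRing) (V := R_NormedModule)
    (fun r => Rpower (1 + r) p) (fun r => Rpower (1 - r) p)); auto. }
assert (Ddif : forall s, 0 <= s < 1 -> is_derive dif s
  ((p - 1) * (Rpower (1 + s) (p - 2) + Rpower (1 - s) (p - 2)))).
{ intros s Hs; unfold dif.
  replace ((p - 1) * (Rpower (1 + s) (p - 2) + Rpower (1 - s) (p - 2)))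
    with ((p - 1) * Rpower (1 + s) (p - 1 - 1)
          - - ((p - 1) * Rpower (1 - s) (p - 1 - 1))).
  2: replace (p - 1 - 1) with (p - 2) by ring; ring.
  apply (is_derive_minus (K := R_AbsRing) (V := R_NormedModule)
    (fun r => Rpower (1 + r) (p - 1)) (fun r => Rpower (1 - r) (p - 1))); auto. }
assert (Hdif : forall s, 0 <= s < 1 -> 0 <= dif s).
{ intros s Hs; unfold dif.
  assert (Rpower (1 - s) (p - 1) <= Rpower (1 + s) (p - 1)); [|lra].
  apply Rle_Rpower_l; lra. }
(* Concavity of the power [(p - 2) / p], at the points [(1 + s) ^ p] and
   [(1 - s) ^ p]. *)
assert (Hjensen : forall s, 0 <= s < 1 ->
  (Rpower (1 + s) (p - 2) + Rpower (1 - s) (p - 2)) / 2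
    <= Rpower (psi s) (1 - 2 / p)).
{ intros s Hs.
  replace (p - 2) with (p * (1 - 2 / p)) by (field; lra).
  rewrite <- !Rpower_mult.
  destruct (Req_dec p 2) as [E|E].
  { replace (1 - 2 / p) with 0 by (rewrite E; field).
    rewrite !Rpower_O by (apply Rpower_pos || apply Hpsi); lra. }
  assert (H2p : 0 < 2 / p < 1).
  { split; [apply Rdiv_lt_0_compat; lra|].
    apply Rmult_lt_reg_r with p; [lra|].
    replace (2 / p * p) with 2 by (field; lra); lra. }
  assert (K := rpow_midpoint_concave (Rpower (1 + s) p) (Rpower (1 - s) p)
    (1 - 2 / p) ltac:(lra) (Rlt_le _ _ (Rpower_pos _ _))
    (Rlt_le _ _ (Rpower_pos _ _))).
  rewrite !rpow_Rpower in K by (apply Rpower_pos || exact (Hpsi s)); exact K. }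
(* Up to a positive factor, the derivative of the function in [Hg] below. *)
set (h := fun s => 2 * (p - 1) * s * Rpower (psi s) (1 - 2 / p) - dif s).
assert (Hh : forall s, 0 <= s < 1 -> 0 <= h s).
{ intros s Hs.
  assert (E0 : h 0 = 0).
  { unfold h, dif; rewrite Rplus_0_r, Rminus_0_r; ring. }
  rewrite <- E0.
  apply nondecreasing_of_derive with (dg := fun r =>
    (2 * (p - 1)) * Rpower (psi r) (1 - 2 / p)
    + (2 * (p - 1) * r) * ((1 - 2 / p) * Rpower (psi r) (1 - 2 / p - 1)
        * (p / 2 * dif r))
    - (p - 1) * (Rpower (1 + r) (p - 2) + Rpower (1 - r) (p - 2))); [lra|].
  intros x Hx; split.
  - unfold h.
    apply (is_derive_minus (K := R_AbsRing) (V := R_NormedModule)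
      (fun r => 2 * (p - 1) * r * Rpower (psi r) (1 - 2 / p)) dif);
      [|apply Ddif; lra].
    apply (is_derive_mult (fun r => 2 * (p - 1) * r)
      (fun r => Rpower (psi r) (1 - 2 / p))).
    + auto_derive; [exact I|ring].
    + apply is_derive_Rpower; [apply Hpsi|apply Dpsi; lra].
    + intros; apply Rmult_comm.
  - assert (J := Hjensen x ltac:(lra)).
    assert (P1 : 0 <= (2 * (p - 1) * x) * ((1 - 2 / p)
      * Rpower (psi x) (1 - 2 / p - 1) * (p / 2 * dif x))).
    { assert (0 <= 1 - 2 / p).
      { replace (1 - 2 / p) with ((p - 2) / p) by (field; lra).
        apply Rdiv_le_0_compat; lra. }
      assert (0 <= dif x) by (apply Hdif; lra).
      assert (0 < Rpower (psi x) (1 - 2 / p - 1)) by apply Rpower_pos.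
      apply Rmult_le_pos; [nra|].
      apply Rmult_le_pos; [apply Rmult_le_pos; lra|].
      apply Rmult_le_pos; lra. }
    nra. }
assert (Hg : Rpower (psi t) (2 / p) <= 1 + (p - 1) * t ^ 2).
{ assert (N : 1 + (p - 1) * 0 ^ 2 - Rpower (psi 0) (2 / p)
              <= 1 + (p - 1) * t ^ 2 - Rpower (psi t) (2 / p)).
  { apply (nondecreasing_of_derive
      (fun s => 1 + (p - 1) * s ^ 2 - Rpower (psi s) (2 / p))
      (fun s => Rpower (psi s) (2 / p - 1) * h s)); [lra|].
    intros x Hx; split.
    - assert (Einv : Rpower (psi x) (2 / p - 1) * Rpower (psi x) (1 - 2 / p) = 1).
      { rewrite <- Rpower_plus; replace (2 / p - 1 + (1 - 2 / p)) with 0 by ring.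
        apply Rpower_O, Hpsi. }
      replace (Rpower (psi x) (2 / p - 1) * h x) with
        (2 * (p - 1) * x - 2 / p * Rpower (psi x) (2 / p - 1) * (p / 2 * dif x)).
      + apply (is_derive_minus (K := R_AbsRing) (V := R_NormedModule)
          (fun s => 1 + (p - 1) * s ^ 2) (fun s => Rpower (psi s) (2 / p))).
        * auto_derive; [exact I|ring].
        * apply is_derive_Rpower; [apply Hpsi|apply Dpsi; lra].
      + transitivity (2 * (p - 1) * x * (Rpower (psi x) (2 / p - 1) *
          Rpower (psi x) (1 - 2 / p)) - Rpower (psi x) (2 / p - 1) * dif x).
        * rewrite Einv; field; lra.
        * unfold h; ring.
    - apply Rmult_le_pos; [left; apply Rpower_pos|apply Hh; lra]. }
  assert (E : Rpower (psi 0) (2 / p) = 1); [|rewrite E in N; lra].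
  unfold psi; rewrite Rplus_0_r, Rminus_0_r, <- (rpow_Rpower 1 p) by lra.
  rewrite rpow_1_l; replace ((1 + 1) / 2) with 1 by field.
  rewrite <- rpow_Rpower, rpow_1_l by lra; reflexivity. }
change (psi t <= Rpower (1 + (p - 1) * t ^ 2) (p / 2)).
replace (psi t) with (Rpower (Rpower (psi t) (2 / p)) (p / 2)).
- apply Rle_Rpower_l; [lra|split; [apply Rpower_pos|exact Hg]].
- rewrite Rpower_mult; replace (2 / p * (p / 2)) with 1 by (field; lra).
  apply Rpower_1, Hpsi.
Qed.

Lemma two_point_ordered p a b : 2 <= p -> 0 <= b < a ->
  (rpow (a + b) p + rpow (a - b) p) / 2
    <= rpow (a ^ 2 + (p - 1) * b ^ 2) (p / 2).
Proof.
intros Hp Hab.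
assert (Ht : 0 <= b / a < 1).
{ split; [apply Rdiv_le_0_compat; lra|].
  apply Rmult_lt_reg_r with a; [lra|].
  replace (b / a * a) with b by (field; lra); lra. }
assert (T := two_point_unit p (b / a) Hp Ht).
set (t := b / a) in *.
replace b with (a * t) by (unfold t; field; lra).
replace (a + a * t) with (a * (1 + t)) by ring.
replace (a - a * t) with (a * (1 - t)) by ring.
replace (a ^ 2 + (p - 1) * (a * t) ^ 2) with (a ^ 2 * (1 + (p - 1) * t ^ 2))
  by ring.
rewrite !rpow_mult by nra.
replace (rpow (a ^ 2) (p / 2)) with (rpow a p).
2: { rewrite <- (rpow_2 a), rpow_rpow by lra; f_equal; field. }
rewrite (rpow_Rpower (1 + t)), (rpow_Rpower (1 - t)),
  (rpow_Rpower (1 + (p - 1) * t ^ 2)) by nra.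
assert (0 < rpow a p) by (apply rpow_pos; lra); nra.
Qed.

(** The diagonal [b = a] is the limit of the preceding case as [b] increases
    to [a]. *)
Lemma two_point_le p a b : 2 <= p -> 0 <= b <= a ->
  (rpow (a + b) p + rpow (a - b) p) / 2
    <= rpow (a ^ 2 + (p - 1) * b ^ 2) (p / 2).
Proof.
intros Hp [Hb [Hab|<-]]; [apply two_point_ordered; lra|].
rewrite Rminus_eq_0, rpow_0, Rplus_0_r.
destruct Hb as [Hb|<-].
2: { rewrite Rplus_0_r, rpow_0.
  generalize (rpow_nonneg (0 ^ 2 + (p - 1) * 0 ^ 2) (p / 2)); lra. }
apply Rnot_lt_le; intros Hlt.
set (rhs := rpow (b ^ 2 + (p - 1) * b ^ 2) (p / 2)) in *.
assert (Hc := rpow_abs_continuous p ltac:(lra) (b + b)).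
apply continuity_pt_filterlim in Hc.
rewrite <- (Rabs_pos_eq (b + b)) in Hlt by lra.
destruct (Hc (rpow (Rabs (b + b)) p - 2 * rhs)) as [delta [Hd H]]; [lra|].
set (e := Rmin (delta / 2) (b / 2)).
assert (He : 0 < e) by (apply Rmin_pos; lra).
assert (He1 : e <= delta / 2) by apply Rmin_l.
assert (He2 : e <= b / 2) by apply Rmin_r.
specialize (H (b + (b - e))); simpl in H; unfold Rdist in H.
assert (T := two_point_ordered p b (b - e) Hp ltac:(lra)).
assert (Hm : rpow (b ^ 2 + (p - 1) * (b - e) ^ 2) (p / 2) <= rhs).
{ assert (Hsq : 0 <= (b - e) ^ 2 <= b ^ 2) by (split; nra).
  apply rpow_le; [lra|split; nra]. }
assert (Hn := rpow_nonneg (b - (b - e)) p).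
assert (Hlim : Rabs (rpow (Rabs (b + (b - e))) p - rpow (Rabs (b + b)) p)
  < rpow (Rabs (b + b)) p - 2 * rhs).
{ apply H; repeat split; [lra|].
  replace (b + (b - e) - (b + b)) with (- e) by ring.
  rewrite Rabs_Ropp, Rabs_pos_eq; lra. }
apply Rabs_def2 in Hlim.
rewrite (Rabs_pos_eq (b + (b - e))) in Hlim by lra; lra.
Qed.

Lemma two_point p a b : 2 <= p -> 0 <= a -> 0 <= b ->
  (rpow (a + b) p + rpow (Rabs (a - b)) p) / 2
    <= rpow (a ^ 2 + (p - 1) * b ^ 2) (p / 2).
Proof.
intros Hp Ha Hb; destruct (Rle_dec b a) as [Hba|Hba].
- rewrite Rabs_pos_eq by lra; apply two_point_le; lra.
- rewrite Rabs_minus_sym, Rabs_pos_eq by lra.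
  apply Rle_trans with (rpow (b ^ 2 + (p - 1) * a ^ 2) (p / 2)).
  + rewrite (Rplus_comm a b); apply two_point_le; lra.
  + assert (Hsq : 0 <= a ^ 2 <= b ^ 2) by (split; nra).
    apply rpow_le; [lra|split; nra].
Qed.

(** The left-hand side is even and convex in [s]. With [A = |w| ^ 2 + |e| ^ 2]
    and [S = 2 |w| |e|] this reduces a statement on complex [w] and [e] to their
    moduli, because [|w + e| ^ 2 = A + s] for some [s] between [- S] and [S]. *)
Lemma rpow_symmetric_spread q A s S : 1 <= q -> Rabs s <= S -> S <= A ->
  rpow (A + s) q + rpow (A - s) q <= rpow (A + S) q + rpow (A - S) q.
Proof.
intros Hq Hs HS.
assert (Hs' := Rle_abs s); assert (Hs'' := Rle_abs (- s)); rewrite Rabs_Ropp in Hs''.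
destruct (Req_dec S 0) as [E|E].
{ replace s with S by lra; lra. }
set (k := (S + s) / (2 * S)).
assert (Hk : 0 <= k <= 1).
{ split; [apply Rdiv_le_0_compat; lra|].
  apply Rmult_le_reg_r with (2 * S); [lra|].
  unfold k; field_simplify; lra. }
assert (C1 := rpow_convex k (A + S) (A - S) q Hq Hk ltac:(lra) ltac:(lra)).
assert (C2 := rpow_convex (1 - k) (A + S) (A - S) q Hq
  ltac:(lra) ltac:(lra) ltac:(lra)).
replace (k * (A + S) + (1 - k) * (A - S)) with (A + s) in C1
  by (unfold k; field; lra).
replace ((1 - k) * (A + S) + (1 - (1 - k)) * (A - S)) with (A - s) in C2
  by (unfold k; field; lra).
lra.
Qed.

(** * Integrals of real functions *)

Lemma RInt_Rplus (f g : R -> R) a b : ex_RInt f a b -> ex_RInt g a b ->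
  RInt (fun t => f t + g t) a b = RInt f a b + RInt g a b.
Proof.
intros Hf Hg; exact (RInt_plus (V := R_CompleteNormedModule) f g a b Hf Hg).
Qed.

Lemma RInt_Rminus (f g : R -> R) a b : ex_RInt f a b -> ex_RInt g a b ->
  RInt (fun t => f t - g t) a b = RInt f a b - RInt g a b.
Proof.
intros Hf Hg; exact (RInt_minus (V := R_CompleteNormedModule) f g a b Hf Hg).
Qed.

Lemma ex_RInt_Rminus (f g : R -> R) a b : ex_RInt f a b -> ex_RInt g a b ->
  ex_RInt (fun t => f t - g t) a b.
Proof.
intros Hf Hg; exact (ex_RInt_minus (V := R_NormedModule) f g a b Hf Hg).
Qed.

Lemma RInt_Rscal (f : R -> R) k a b : ex_RInt f a b ->
  RInt (fun t => k * f t) a b = k * RInt f a b.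
Proof. intros Hf; exact (RInt_scal (V := R_CompleteNormedModule) f a b k Hf). Qed.

Lemma RInt_Rconst (k a b : R) : RInt (fun _ => k) a b = (b - a) * k.
Proof. exact (RInt_const (V := R_CompleteNormedModule) a b k). Qed.

Lemma RInt_RChasles (f : R -> R) a b c : ex_RInt f a b -> ex_RInt f b c ->
  RInt f a c = RInt f a b + RInt f b c.
Proof.
intros H1 H2; symmetry.
exact (RInt_Chasles (V := R_CompleteNormedModule) f a b c H1 H2).
Qed.

Lemma ex_RInt_Rcont (f : R -> R) a b :
  (forall t, Rmin a b <= t <= Rmax a b -> continuous f t) -> ex_RInt f a b.
Proof. exact (ex_RInt_continuous (V := R_CompleteNormedModule) f a b). Qed.

(** * Cauchy's theorem on rectangles *)

Definition contained (x y w h a b c d : R) : Prop :=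
  0 <= w /\ 0 <= h /\ a <= x /\ x + w <= b /\ c <= y /\ y + h <= d.

(** If [P] failed for the whole rectangle it would fail for one of its quarters,
    then for a quarter of that one, and so on. The nested rectangles obtained in
    this way shrink to a point, where the local hypothesis gives [P]. *)
Lemma quadrisection_induction (P : R -> R -> R -> R -> Prop) :
  (forall x y w h,
     P x y (w / 2) (h / 2) -> P (x + w / 2) y (w / 2) (h / 2) ->
     P x (y + h / 2) (w / 2) (h / 2) ->
     P (x + w / 2) (y + h / 2) (w / 2) (h / 2) -> P x y w h) ->
  forall a c W H, 0 <= W -> 0 <= H ->
  (forall x y, a <= x <= a + W -> c <= y <= c + H ->
     exists delta, 0 < delta /\
       forall x' y' w h, 0 <= w < delta -> 0 <= h < delta ->
         x' <= x <= x' + w -> y' <= y <= y' + h -> P x' y' w h) ->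
  P a c W H.
Proof.
intros Hquad a c W H HW HH Hloc.
apply NNPP; intros Hbad.
set (side := fun (L : R) (n : nat) => L / 2 ^ n).
assert (Hpow : forall n, 0 < 2 ^ n) by (intros n; apply pow_lt; lra).
assert (Hside : forall L n, side L (S n) = side L n / 2).
{ intros L n; unfold side; simpl; field; apply Rgt_not_eq, Hpow. }
assert (Hside0 : forall L n, 0 <= L -> 0 <= side L n).
{ intros L n HL; unfold side; apply Rdiv_le_0_compat; auto. }
(* The first quarter for which [P] fails; the last one is taken when [P] holds
   for the three others. *)
set (step := fun (n : nat) (q : R * R) =>
  let w := side W (S n) in let h := side H (S n) in
  let (x, y) := q in
  if excluded_middle_informative (P x y w h) then
    if excluded_middle_informative (P (x + w) y w h) then
      if excluded_middle_informative (P x (y + h) w h) then (x + w, y + h)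
      else (x, y + h)
    else (x + w, y)
  else (x, y)).
set (corner := fix corner n := match n with
  | O => (a, c) | S m => step m (corner m) end).
assert (Hbadn : forall n,
  ~ P (fst (corner n)) (snd (corner n)) (side W n) (side H n)).
{ induction n as [|n IH].
  - simpl; unfold side; simpl. rewrite !Rdiv_1_r. exact Hbad.
  - change (corner (S n)) with (step n (corner n)).
    destruct (corner n) as [x y]; simpl in IH.
    unfold step.
    destruct (excluded_middle_informative _) as [P1|P1]; [|exact P1].
    destruct (excluded_middle_informative _) as [P2|P2]; [|exact P2].
    destruct (excluded_middle_informative _) as [P3|P3]; [|exact P3].
    simpl; intros P4; apply IH; apply Hquad; rewrite <- !Hside; assumption. }
assert (Hmono : forall n,
  (fst (corner n) <= fst (corner (S n)) /\
   fst (corner (S n)) + side W (S n) <= fst (corner n) + side W n) /\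
  (snd (corner n) <= snd (corner (S n)) /\
   snd (corner (S n)) + side H (S n) <= snd (corner n) + side H n)).
{ intros n.
  change (corner (S n)) with (step n (corner n)).
  destruct (corner n) as [x y]; unfold step.
  generalize (Hside W n) (Hside H n) (Hside0 W (S n) HW) (Hside0 H (S n) HH).
  intros.
  repeat destruct (excluded_middle_informative _); simpl fst; simpl snd; lra. }
assert (Hnest : forall (u : nat -> R) (L : R), 0 <= L ->
  (forall n, u n <= u (S n) /\ u (S n) + side L (S n) <= u n + side L n) ->
  exists l, forall n, u n <= l <= u n + side L n).
{ intros u L HL Hu.
  assert (Hup : forall n k, u n <= u (n + k)%nat /\
    u (n + k)%nat + side L (n + k)%nat <= u n + side L n).
  { intros n; induction k as [|k IH].
    - rewrite Nat.add_0_r; lra.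
    - rewrite Nat.add_succ_r; generalize (Hu (n + k)%nat); lra. }
  assert (Hcross : forall n m, u m <= u n + side L n).
  { intros n m; destruct (Nat.le_ge_cases n m) as [Hnm|Hnm].
    - replace m with (n + (m - n))%nat by lia.
      generalize (Hup n (m - n)%nat) (Hside0 L (n + (m - n))%nat HL); lra.
    - replace n with (m + (n - m))%nat by lia.
      generalize (Hup m (n - m)%nat) (Hside0 L (m + (n - m))%nat HL); lra. }
  destruct (completeness (fun x => exists n, x = u n)) as [l [Hl1 Hl2]].
  - exists (u O + side L O); intros x [n ->]; apply Hcross.
  - exists (u O), O; reflexivity.
  - exists l; intros n; split.
    + apply Hl1; exists n; reflexivity.
    + apply Hl2; intros x [m ->]; apply Hcross. }
destruct (Hnest (fun n => fst (corner n)) W HW) as [x Hx];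
  [intros n; apply Hmono|].
destruct (Hnest (fun n => snd (corner n)) H HH) as [y Hy];
  [intros n; apply Hmono|].
assert (Hsmall : forall L delta, 0 < delta -> 0 <= L ->
  exists N, forall n, (N <= n)%nat -> side L n < delta).
{ intros L delta Hd HL.
  destruct (pow_lt_1_zero (/ 2)) with (y := delta / (L + 1)) as [N HN].
  - rewrite Rabs_pos_eq; lra.
  - apply Rdiv_lt_0_compat; lra.
  - exists N; intros n Hn; generalize (HN n Hn); intros Hlt.
    rewrite Rabs_pos_eq in Hlt by (apply pow_le; lra).
    rewrite pow_inv in Hlt.
    apply (Rmult_lt_compat_r (L + 1)) in Hlt; [|lra].
    unfold side, Rdiv; rewrite Rmult_comm.
    replace (delta / (L + 1) * (L + 1)) with delta in Hlt by (field; lra).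
    assert (0 < / 2 ^ n) by (apply Rinv_0_lt_compat, Hpow).
    nra. }
destruct (Hloc x y) as [delta [Hd HP]].
- generalize (Hx O); unfold side; simpl; rewrite Rdiv_1_r; auto.
- generalize (Hy O); unfold side; simpl; rewrite Rdiv_1_r; auto.
- destruct (Hsmall W delta Hd HW) as [N1 HN1].
  destruct (Hsmall H delta Hd HH) as [N2 HN2].
  apply (Hbadn (N1 + N2)%nat), HP; auto.
  + split; [auto|apply HN1; lia].
  + split; [auto|apply HN2; lia].
Qed.

(** Complex differentiability, with derivative [b1 + i b2], of the function
    [u + i v] of [x + i y]. The real form lets Cauchy's theorem be proved with
    real integrals only. *)
Definition complex_diff_pt (u v : R -> R -> R) (x y : R) : Prop :=
  exists b1 b2, forall eps, 0 < eps -> exists delta, 0 < delta /\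
    forall x' y', Rabs (x' - x) < delta -> Rabs (y' - y) < delta ->
      Rabs (u x' y' - u x y - (b1 * (x' - x) - b2 * (y' - y)))
        <= eps * (Rabs (x' - x) + Rabs (y' - y)) /\
      Rabs (v x' y' - v x y - (b2 * (x' - x) + b1 * (y' - y)))
        <= eps * (Rabs (x' - x) + Rabs (y' - y)).

Lemma continuous_of_linear_bound (g : R -> R) (t k : R) :
  (exists delta, 0 < delta /\
     forall s, Rabs (s - t) < delta -> Rabs (g s - g t) <= k * Rabs (s - t)) ->
  continuous g t.
Proof.
intros [delta [Hd Hg]].
apply continuity_pt_filterlim.
intros eps Heps.
exists (Rmin delta (eps / (Rabs k + 1))); split.
- apply Rmin_pos; [exact Hd|].
  apply Rdiv_lt_0_compat; [exact Heps|generalize (Rabs_pos k); lra].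
- intros s [_ Hs]; simpl in Hs; unfold Rdist in Hs.
  simpl; unfold Rdist.
  apply Rle_lt_trans with (1 := Hg s (Rlt_le_trans _ _ _ Hs (Rmin_l _ _))).
  assert (Hs2 := Rlt_le_trans _ _ _ Hs (Rmin_r _ _)).
  assert (Hk : 0 < Rabs k + 1) by (generalize (Rabs_pos k); lra).
  apply (Rmult_lt_compat_r (Rabs k + 1)) in Hs2; [|exact Hk].
  replace (eps / (Rabs k + 1) * (Rabs k + 1)) with eps in Hs2 by (field; lra).
  generalize (Rabs_pos (s - t)) (Rle_abs k); nra.
Qed.

Lemma complex_diff_pt_continuous u v x y :
  complex_diff_pt u v x y ->
  continuous (fun t => v t y) x /\ continuous (fun t => u x t) y.
Proof.
intros (b1 & b2 & Hb).
destruct (Hb 1 Rlt_0_1) as (delta & Hd & H).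
assert (Htri : forall p q r e : R, Rabs (p - q - r) <= e ->
  Rabs (p - q) <= Rabs r + e).
{ intros p q r e He. replace (p - q) with (r + (p - q - r)) by ring.
  apply Rle_trans with (1 := Rabs_triang _ _); lra. }
split.
- apply continuous_of_linear_bound with (Rabs b2 + 1); exists delta; split; auto.
  intros s Hs; destruct (H s y Hs) as [_ H2].
  { rewrite Rminus_eq_0, Rabs_R0; exact Hd. }
  rewrite Rminus_eq_0, Rabs_R0, Rmult_0_r, !Rplus_0_r, Rmult_1_l in H2.
  apply Htri in H2; rewrite Rabs_mult in H2; lra.
- apply continuous_of_linear_bound with (Rabs b2 + 1); exists delta; split; auto.
  intros s Hs; destruct (H x s) as [H1 _]; auto.
  { rewrite Rminus_eq_0, Rabs_R0; exact Hd. }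
  rewrite Rminus_eq_0, Rabs_R0, Rmult_0_r, Rplus_0_l, Rmult_1_l in H1.
  apply Htri in H1.
  replace (0 - b2 * (s - y)) with (- (b2 * (s - y))) in H1 by ring.
  rewrite Rabs_Ropp, Rabs_mult in H1; lra.
Qed.

(** Imaginary part of the integral of [u + i v] along the boundary of the
    rectangle with lower left corner [(x, y)] and sides [w] and [h]. *)
Definition boundary_integral (u v : R -> R -> R) (x y w h : R) : R :=
  RInt (fun t => v t y - v t (y + h)) x (x + w)
  + RInt (fun t => u (x + w) t - u x t) y (y + h).

(** For an affine function both integrands are constant and the two integrals
    cancel, so only the remainders of the first order expansion contribute. In
    each integrand they are at most [eps (w + h)]. *)
Lemma boundary_integral_near u v x0 y0 eps :
  complex_diff_pt u v x0 y0 -> 0 < eps ->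
  exists delta, 0 < delta /\
    forall x y w h, 0 <= w < delta -> 0 <= h < delta ->
      x <= x0 <= x + w -> y <= y0 <= y + h ->
      ex_RInt (fun t => v t y - v t (y + h)) x (x + w) ->
      ex_RInt (fun t => u (x + w) t - u x t) y (y + h) ->
      Rabs (boundary_integral u v x y w h) <= eps * (w + h) ^ 2.
Proof.
intros (b1 & b2 & Hb) Heps.
destruct (Hb (eps / 2)) as (delta & Hd & H); [lra|].
exists delta; split; [exact Hd|].
intros x y w h Hw Hh Hx Hy I1 I2.
assert (Habs : forall t s l, 0 <= l -> t <= s <= t + l ->
   forall r, t <= r <= t + l -> Rabs (r - s) <= l).
{ intros; apply Rabs_le; lra. }
assert (B1 : Rabs (RInt (fun t => v t y - v t (y + h) + b1 * h) x (x + w))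
             <= (x + w - x) * (eps * (w + h))).
{ apply abs_RInt_le_const; [lra| |].
  - apply (ex_RInt_plus (V := R_NormedModule)); [exact I1|apply ex_RInt_const].
  - intros t Ht.
    assert (Ht0 := Habs x x0 w (proj1 Hw) Hx t Ht).
    assert (Hy0 := Habs y y0 h (proj1 Hh) Hy y ltac:(lra)).
    assert (Hy1 := Habs y y0 h (proj1 Hh) Hy (y + h) ltac:(lra)).
    destruct (H t y) as [_ E1]; [lra|lra|].
    destruct (H t (y + h)) as [_ E2]; [lra|lra|].
    replace (v t y - v t (y + h) + b1 * h) with
      ((v t y - v x0 y0 - (b2 * (t - x0) + b1 * (y - y0)))
       + - (v t (y + h) - v x0 y0 - (b2 * (t - x0) + b1 * (y + h - y0))))
      by ring.
    apply Rle_trans with (1 := Rabs_triang _ _); rewrite Rabs_Ropp.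
    apply Rle_trans with (1 := Rplus_le_compat _ _ _ _ E1 E2); nra. }
assert (B2 : Rabs (RInt (fun t => u (x + w) t - u x t + - (b1 * w)) y (y + h))
             <= (y + h - y) * (eps * (w + h))).
{ apply abs_RInt_le_const; [lra| |].
  - apply (ex_RInt_plus (V := R_NormedModule)); [exact I2|apply ex_RInt_const].
  - intros t Ht.
    assert (Ht0 := Habs y y0 h (proj1 Hh) Hy t Ht).
    assert (Hx0 := Habs x x0 w (proj1 Hw) Hx x ltac:(lra)).
    assert (Hx1 := Habs x x0 w (proj1 Hw) Hx (x + w) ltac:(lra)).
    destruct (H (x + w) t) as [E1 _]; [lra|lra|].
    destruct (H x t) as [E2 _]; [lra|lra|].
    replace (u (x + w) t - u x t + - (b1 * w)) with
      ((u (x + w) t - u x0 y0 - (b1 * (x + w - x0) - b2 * (t - y0)))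
       + - (u x t - u x0 y0 - (b1 * (x - x0) - b2 * (t - y0))))
      by ring.
    apply Rle_trans with (1 := Rabs_triang _ _); rewrite Rabs_Ropp.
    apply Rle_trans with (1 := Rplus_le_compat _ _ _ _ E1 E2); nra. }
assert (Hplus : forall g k a b, ex_RInt g a b ->
  RInt (fun t => g t + k) a b = RInt g a b + (b - a) * k).
{ intros g k a b Hg.
  rewrite RInt_Rplus; [|exact Hg|apply ex_RInt_const].
  rewrite RInt_Rconst; reflexivity. }
rewrite Hplus in B1 by exact I1.
rewrite Hplus in B2 by exact I2.
unfold boundary_integral.
match goal with |- Rabs (?p + ?q) <= _ => set (p0 := p) in *; set (q0 := q) in * end.
replace (p0 + q0) with ((p0 + (x + w - x) * (b1 * h))
  + (q0 + (y + h - y) * - (b1 * w))) by ring.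
apply Rle_trans with (1 := Rabs_triang _ _).
apply Rle_trans with (1 := Rplus_le_compat _ _ _ _ B1 B2); nra.
Qed.

Section Rectangle.
Variables (u v : R -> R -> R) (a b c d : R).
Hypothesis Hdiff : forall x y, a <= x <= b -> c <= y <= d ->
  complex_diff_pt u v x y.

Lemma ex_RInt_v y x1 x2 : a <= x1 <= b -> a <= x2 <= b -> c <= y <= d ->
  ex_RInt (fun t => v t y) x1 x2.
Proof.
intros H1 H2 Hy; apply ex_RInt_Rcont.
intros z Hz.
apply complex_diff_pt_continuous with u, Hdiff; [|exact Hy].
revert Hz; apply Rmin_case; apply Rmax_case; lra.
Qed.

Lemma ex_RInt_u x y1 y2 : c <= y1 <= d -> c <= y2 <= d -> a <= x <= b ->
  ex_RInt (fun t => u x t) y1 y2.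
Proof.
intros H1 H2 Hx; apply ex_RInt_Rcont.
intros z Hz.
apply complex_diff_pt_continuous with v, Hdiff; [exact Hx|].
revert Hz; apply Rmin_case; apply Rmax_case; lra.
Qed.

Lemma boundary_integral_split x y w h :
  contained x y w h a b c d ->
  boundary_integral u v x y w h =
  RInt (fun t => v t y) x (x + w) - RInt (fun t => v t (y + h)) x (x + w)
  + (RInt (fun t => u (x + w) t) y (y + h) - RInt (fun t => u x t) y (y + h)).
Proof.
intros (Hw & Hh & H1 & H2 & H3 & H4); unfold boundary_integral.
rewrite (RInt_Rminus (fun t => v t y) (fun t => v t (y + h)));
  [|apply ex_RInt_v; lra|apply ex_RInt_v; lra].
rewrite (RInt_Rminus (fun t => u (x + w) t) (fun t => u x t));
  [|apply ex_RInt_u; lra|apply ex_RInt_u; lra].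
reflexivity.
Qed.

Lemma boundary_integral_quarters x y w h :
  contained x y w h a b c d ->
  boundary_integral u v x y w h =
  boundary_integral u v x y (w / 2) (h / 2)
  + boundary_integral u v (x + w / 2) y (w / 2) (h / 2)
  + boundary_integral u v x (y + h / 2) (w / 2) (h / 2)
  + boundary_integral u v (x + w / 2) (y + h / 2) (w / 2) (h / 2).
Proof.
intros (Hw & Hh & H1 & H2 & H3 & H4).
rewrite !boundary_integral_split by (unfold contained; repeat split; lra).
replace (x + w / 2 + w / 2) with (x + w) by field.
replace (y + h / 2 + h / 2) with (y + h) by field.
assert (Cv : forall s, c <= s <= d ->
  RInt (fun t => v t s) x (x + w) =
  RInt (fun t => v t s) x (x + w / 2)
  + RInt (fun t => v t s) (x + w / 2) (x + w)).
{ intros s Hs; apply RInt_RChasles;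
    (apply ex_RInt_v; lra). }
assert (Cu : forall s, a <= s <= b ->
  RInt (fun t => u s t) y (y + h) =
  RInt (fun t => u s t) y (y + h / 2)
  + RInt (fun t => u s t) (y + h / 2) (y + h)).
{ intros s Hs; apply RInt_RChasles;
    apply ex_RInt_u; lra. }
rewrite (Cv y), (Cv (y + h)), (Cu x), (Cu (x + w)) by lra; ring.
Qed.

(** The bound [eps (w + h) ^ 2] is additive under division into quarters and
    holds near every point, hence it holds for the whole rectangle. *)
Lemma goursat_rectangle w h : contained a c w h a b c d ->
  boundary_integral u v a c w h = 0.
Proof.
intros Hin.
assert (Hw := proj1 Hin); assert (Hh := proj1 (proj2 Hin)).
assert (Hsmall : forall eps, 0 < eps ->
  Rabs (boundary_integral u v a c w h) <= eps * (w + h) ^ 2).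
{ intros eps Heps; revert Hin.
  apply (quadrisection_induction (fun x y w h =>
    contained x y w h a b c d ->
    Rabs (boundary_integral u v x y w h) <= eps * (w + h) ^ 2)); auto.
  - intros x y w0 h0 Q1 Q2 Q3 Q4 Hin.
    rewrite boundary_integral_quarters by exact Hin.
    destruct Hin as (? & ? & ? & ? & ? & ?).
    specialize (Q1 ltac:(unfold contained; repeat split; lra)).
    specialize (Q2 ltac:(unfold contained; repeat split; lra)).
    specialize (Q3 ltac:(unfold contained; repeat split; lra)).
    specialize (Q4 ltac:(unfold contained; repeat split; lra)).
    replace (eps * (w0 + h0) ^ 2) with
      (eps * (w0 / 2 + h0 / 2) ^ 2 + eps * (w0 / 2 + h0 / 2) ^ 2
       + eps * (w0 / 2 + h0 / 2) ^ 2 + eps * (w0 / 2 + h0 / 2) ^ 2) by field.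
    repeat (eapply Rle_trans; [apply Rabs_triang|apply Rplus_le_compat; trivial]).
  - intros x y Hx Hy.
    destruct (classic (a <= x <= b /\ c <= y <= d)) as [[Hx' Hy']|Hout].
    + destruct (boundary_integral_near u v x y eps (Hdiff x y Hx' Hy') Heps)
        as (delta & Hd & H).
      exists delta; split; [exact Hd|].
      intros x1 y1 w1 h1 Hw1 Hh1 Hx1 Hy1 (? & ? & ? & ? & ? & ?).
      apply H; auto.
      * apply (ex_RInt_Rminus (fun t => v t y1) (fun t => v t (y1 + h1)));
          apply ex_RInt_v; lra.
      * apply (ex_RInt_Rminus (fun t => u (x1 + w1) t) (fun t => u x1 t));
          apply ex_RInt_u; lra.
    + exists 1; split; [lra|].
      intros x1 y1 w1 h1 Hw1 Hh1 Hx1 Hy1 (? & ? & ? & ? & ? & ?).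
      exfalso; apply Hout; lra. }
destruct (Req_dec (boundary_integral u v a c w h) 0) as [E|E]; [exact E|].
exfalso.
assert (Hpos := Rabs_pos_lt _ E).
set (m := Rabs (boundary_integral u v a c w h)) in *.
assert (Hk : 0 < (w + h) ^ 2 + 1) by nra.
specialize (Hsmall (m / ((w + h) ^ 2 + 1)) (Rdiv_lt_0_compat _ _ Hpos Hk)).
assert (m * ((w + h) ^ 2 + 1) <= m * (w + h) ^ 2); [|lra].
apply (Rmult_le_compat_r ((w + h) ^ 2 + 1)) in Hsmall; [|lra].
replace (m / ((w + h) ^ 2 + 1) * (w + h) ^ 2 * ((w + h) ^ 2 + 1))
  with (m * (w + h) ^ 2) in Hsmall by (field; lra).
exact Hsmall.
Qed.
End Rectangle.

(** * The mean value property *)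

Definition complex_diff (F : C -> C) (z : C) : Prop :=
  exists B : C, forall eps, 0 < eps -> exists delta, 0 < delta /\
    forall w : C, Cmod (w - z)%C < delta ->
      Cmod (F w - F z - B * (w - z))%C <= eps * Cmod (w - z)%C.

Definition disk_diff (F : C -> C) : Prop :=
  forall z, Cmod z < 1 -> complex_diff F z.

Lemma holomorphic_disk_diff f : holomorphic_on_disk f -> disk_diff f.
Proof.
intros Hf z Hz; destruct (Hf z Hz) as [l [_ Hl]].
exists l; intros eps Heps.
destruct (Hl z (fun P H => H) (mkposreal eps Heps)) as [delta Hd].
exists delta; split; [apply cond_pos|].
intros w Hw; specialize (Hd w Hw).
replace (l * (w - z))%C with ((w - z) * l)%C by ring.
exact Hd.
Qed.

Lemma linear_approximation (g : R -> R) (l : R) : derivable_pt_lim g 0 l ->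
  forall eps, 0 < eps -> exists delta, 0 < delta /\
    forall t, Rabs t < delta -> Rabs (g t - g 0 - l * t) <= eps * Rabs t.
Proof.
intros Hg eps Heps; destruct (Hg eps Heps) as [delta Hd].
exists delta; split; [apply cond_pos|].
intros t Ht; destruct (Req_dec t 0) as [->|Hn].
{ rewrite Rabs_R0; replace (g 0 - g 0 - l * 0) with 0 by ring.
  rewrite Rabs_R0; lra. }
specialize (Hd t Hn Ht); rewrite Rplus_0_l in Hd.
replace (g t - g 0 - l * t) with (((g t - g 0) / t - l) * t) by (field; exact Hn).
rewrite Rabs_mult; apply Rmult_le_compat_r; [apply Rabs_pos|lra].
Qed.

Lemma Cmod_le_abs (x y : R) : Cmod (x, y) <= Rabs x + Rabs y.
Proof.
unfold Cmod; simpl fst; simpl snd.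
generalize (Rabs_pos x) (Rabs_pos y); intros Hx Hy.
apply Rsqr_incr_0_var; [|lra].
rewrite Rsqr_sqrt by nra; unfold Rsqr.
replace (x ^ 2) with (Rabs x ^ 2) by apply pow2_abs.
replace (y ^ 2) with (Rabs y ^ 2) by apply pow2_abs.
nra.
Qed.

Lemma im_le_Cmod (z : C) : Rabs (Im z) <= Cmod z.
Proof.
unfold Cmod, Im; rewrite <- sqrt_Rsqr_abs; apply sqrt_le_1_alt.
unfold Rsqr; generalize (pow2_ge_0 (fst z)); simpl; lra.
Qed.

Lemma Cmod_polar rho t : 0 <= rho -> Cmod (polar rho t) = rho.
Proof.
intros Hr; unfold Cmod, polar; simpl fst; simpl snd.
replace ((rho * cos t) ^ 2 + (rho * sin t) ^ 2) with (rho ^ 2).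
- apply sqrt_pow2; exact Hr.
- generalize (sin2_cos2 t); unfold Rsqr; intros E.
  replace (rho ^ 2) with (rho ^ 2 * (sin t * sin t + cos t * cos t))
    by (rewrite E; ring); ring.
Qed.

Lemma polar_mult r1 r2 t1 t2 :
  (polar r1 t1 * polar r2 t2)%C = polar (r1 * r2) (t1 + t2).
Proof.
unfold polar, Cmult; simpl; rewrite cos_plus, sin_plus; f_equal; ring.
Qed.

Lemma polar_period r t : polar r (t + 2 * PI) = polar r t.
Proof. unfold polar; rewrite cos_plus, sin_plus, cos_2PI, sin_2PI; f_equal; ring. Qed.

(** Since [polar (exp a) b] is the complex exponential of [a + i b], this is its
    derivative at [0]. *)
Lemma polar_exp_increment eps : 0 < eps -> exists delta, 0 < delta /\
  forall a b, Rabs a < delta -> Rabs b < delta ->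
    Cmod (polar (exp a) b - 1 - (a, b))%C <= eps * (Rabs a + Rabs b).
Proof.
intros Heps.
set (eta := Rmin 1 (eps / 8)).
assert (Heta : 0 < eta) by (apply Rmin_pos; lra).
assert (Heta1 : eta <= 1) by apply Rmin_l.
assert (Heta2 : eta <= eps / 8) by apply Rmin_r.
destruct (linear_approximation exp 1 derivable_pt_lim_exp_0 eta Heta)
  as (d1 & Hd1 & H1).
destruct (linear_approximation cos 0) with (eps := eta) as (d2 & Hd2 & H2).
{ generalize (derivable_pt_lim_cos 0); rewrite sin_0, Ropp_0; auto. }
{ exact Heta. }
destruct (linear_approximation sin 1) with (eps := eta) as (d3 & Hd3 & H3).
{ generalize (derivable_pt_lim_sin 0); rewrite cos_0; auto. }
{ exact Heta. }
exists (Rmin eta (Rmin d1 (Rmin d2 d3))).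
split; [apply Rmin_pos; [|apply Rmin_pos; [|apply Rmin_pos]]; assumption|].
intros a b Ha Hb.
assert (Hmin : forall t, Rabs t < Rmin eta (Rmin d1 (Rmin d2 d3)) ->
  Rabs t < eta /\ Rabs t < d1 /\ Rabs t < d2 /\ Rabs t < d3).
{ intros t Ht.
  generalize (Rmin_l eta (Rmin d1 (Rmin d2 d3))) (Rmin_r eta (Rmin d1 (Rmin d2 d3)))
    (Rmin_l d1 (Rmin d2 d3)) (Rmin_r d1 (Rmin d2 d3)) (Rmin_l d2 d3) (Rmin_r d2 d3).
  lra. }
destruct (Hmin a Ha) as (Ae & A1 & _ & _).
destruct (Hmin b Hb) as (_ & _ & B2 & B3).
specialize (H1 a A1); specialize (H2 b B2); specialize (H3 b B3).
rewrite exp_0 in H1; rewrite cos_0 in H2; rewrite sin_0 in H3.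
rewrite Rmult_1_l in H1, H3; rewrite Rmult_0_l, Rminus_0_r in H2.
rewrite Rminus_0_r in H3.
assert (Pa := Rabs_pos a); assert (Pb := Rabs_pos b).
assert (Hcos : Rabs (cos b) <= 1) by (apply Rabs_le; generalize (COS_bound b); lra).
assert (Hexp : Rabs (exp a - 1) <= 2 * Rabs a).
{ replace (exp a - 1) with ((exp a - 1 - a) + a) by ring.
  apply Rle_trans with (1 := Rabs_triang _ _); nra. }
assert (Hsin : Rabs (sin b) <= 2 * Rabs b).
{ replace (sin b) with ((sin b - b) + b) by ring.
  apply Rle_trans with (1 := Rabs_triang _ _); nra. }
replace (polar (exp a) b - 1 - (a, b))%C with
  (((exp a - 1 - a) * cos b + ((cos b - 1) + a * (cos b - 1)))%R,
   ((exp a - 1) * sin b + (sin b - b))%R)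
  by (unfold polar, Cminus, Cplus, Copp; simpl; f_equal; ring).
apply Rle_trans with (1 := Cmod_le_abs _ _).
assert (E1 : Rabs ((exp a - 1 - a) * cos b + ((cos b - 1) + a * (cos b - 1)))
  <= eta * Rabs a + (eta * Rabs b + eta * Rabs b)).
{ apply Rle_trans with (1 := Rabs_triang _ _); apply Rplus_le_compat.
  - rewrite Rabs_mult; generalize (Rabs_pos (exp a - 1 - a)); nra.
  - apply Rle_trans with (1 := Rabs_triang _ _); apply Rplus_le_compat; [lra|].
    rewrite Rabs_mult; generalize (Rabs_pos (cos b - 1)); nra. }
assert (E2 : Rabs ((exp a - 1) * sin b + (sin b - b))
  <= 4 * eta * Rabs b + eta * Rabs b).
{ apply Rle_trans with (1 := Rabs_triang _ _); apply Rplus_le_compat; [|lra].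
  rewrite Rabs_mult.
  apply Rle_trans with (2 * Rabs a * (2 * Rabs b)); [|nra].
  apply Rmult_le_compat; try apply Rabs_pos; assumption. }
nra.
Qed.

Lemma polar_exp_diff x y eps : 0 < eps -> exists delta, 0 < delta /\
  forall x' y', Rabs (x' - x) < delta -> Rabs (y' - y) < delta ->
    Cmod (polar (exp x') y' - polar (exp x) y
          - polar (exp x) y * (x' - x, y' - y)%R)%C
      <= eps * (Rabs (x' - x) + Rabs (y' - y)).
Proof.
intros Heps; assert (Hx := exp_pos x).
destruct (polar_exp_increment (eps / exp x)) as (delta & Hd & H).
{ apply Rdiv_lt_0_compat; assumption. }
exists delta; split; [exact Hd|].
intros x' y' Hx' Hy'; specialize (H _ _ Hx' Hy').
replace (polar (exp x') y') with (polar (exp x) y * polar (exp (x' - x)) (y' - y))%C.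
2: { rewrite polar_mult, <- exp_plus; f_equal; [f_equal|]; ring. }
match goal with |- Cmod ?z <= _ => replace z with
  (polar (exp x) y * (polar (exp (x' - x)) (y' - y) - 1 - (x' - x, y' - y)%R))%C
  by ring end.
rewrite Cmod_mult, Cmod_polar by lra.
apply (Rmult_le_compat_l (exp x)) in H; [|lra].
apply Rle_trans with (1 := H); right; field; lra.
Qed.

Lemma complex_diff_exp_disk (F : C -> C) (z0 kappa : C) x y :
  complex_diff F (z0 + kappa * polar (exp x) y)%C ->
  complex_diff_pt (fun s t => Re (F (z0 + kappa * polar (exp s) t)%C))
    (fun s t => Im (F (z0 + kappa * polar (exp s) t)%C)) x y.
Proof.
intros [B HB].
set (E := polar (exp x) y) in *.
set (D := (B * kappa * E)%C).
exists (fst D), (snd D); intros eps Heps.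
assert (HE : Cmod E = exp x) by (apply Cmod_polar; left; apply exp_pos).
assert (Hx := exp_pos x); assert (Hk := Cmod_ge_0 kappa); assert (HB0 := Cmod_ge_0 B).
set (L := Cmod kappa * (exp x + 1) + 1).
assert (HL : 0 < L) by (unfold L; nra).
set (M := Cmod B * Cmod kappa + 1).
assert (HM : 0 < M) by (unfold M; nra).
destruct (HB (eps / (2 * L))) as (d1 & Hd1 & H1).
{ apply Rdiv_lt_0_compat; lra. }
set (eta := Rmin 1 (eps / (2 * M))).
assert (Heta : 0 < eta) by (apply Rmin_pos; [lra|apply Rdiv_lt_0_compat; lra]).
destruct (polar_exp_diff x y eta Heta) as (d2 & Hd2 & H2); fold E in H2.
exists (Rmin d2 (d1 / (2 * L))); split.
{ apply Rmin_pos; [exact Hd2|apply Rdiv_lt_0_compat; lra]. }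
intros x' y' Hx' Hy'.
assert (Hx1 := Rlt_le_trans _ _ _ Hx' (Rmin_r _ _)).
assert (Hy1 := Rlt_le_trans _ _ _ Hy' (Rmin_r _ _)).
specialize (H2 x' y' (Rlt_le_trans _ _ _ Hx' (Rmin_l _ _))
  (Rlt_le_trans _ _ _ Hy' (Rmin_l _ _))).
set (E' := polar (exp x') y') in *.
set (dd := (x' - x, y' - y)%R : C) in *.
set (s := Rabs (x' - x) + Rabs (y' - y)) in *.
assert (Hs0 : 0 <= s).
{ unfold s; generalize (Rabs_pos (x' - x)) (Rabs_pos (y' - y)); lra. }
assert (Hs : s < d1 / L).
{ replace (d1 / L) with (d1 / (2 * L) + d1 / (2 * L)) by (field; lra).
  unfold s; lra. }
assert (Hdd : Cmod dd <= s) by apply Cmod_le_abs.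
assert (Heta1 : eta <= 1) by apply Rmin_l.
assert (HEE : Cmod (E' - E)%C <= (exp x + 1) * s).
{ replace (E' - E)%C with ((E' - E - E * dd) + E * dd)%C by ring.
  apply Rle_trans with (1 := Cmod_triangle _ _).
  rewrite Cmod_mult, HE; nra. }
set (z := (z0 + kappa * E)%C) in *.
set (z' := (z0 + kappa * E')%C).
assert (Hzz : (z' - z = kappa * (E' - E))%C) by (unfold z, z'; ring).
assert (HzL : Cmod (z' - z)%C <= L * s).
{ rewrite Hzz, Cmod_mult; unfold L; nra. }
assert (Hz1 : Cmod (z' - z)%C < d1).
{ apply Rle_lt_trans with (1 := HzL).
  apply (Rmult_lt_compat_l L) in Hs; [|exact HL].
  replace (L * (d1 / L)) with d1 in Hs by (field; lra); exact Hs. }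
specialize (H1 z' Hz1).
assert (Hmain : Cmod (F z' - F z - D * dd)%C <= eps * s).
{ replace (F z' - F z - D * dd)%C with
    ((F z' - F z - B * (z' - z)) + B * kappa * (E' - E - E * dd))%C
    by (rewrite Hzz; unfold D; ring).
  apply Rle_trans with (1 := Cmod_triangle _ _).
  rewrite !Cmod_mult.
  assert (T1 : eps / (2 * L) * Cmod (z' - z)%C <= eps / 2 * s).
  { apply Rle_trans with (eps / (2 * L) * (L * s)).
    - apply Rmult_le_compat_l; [|exact HzL].
      left; apply Rdiv_lt_0_compat; lra.
    - right; field; lra. }
  assert (Heta2 : M * eta <= eps / 2).
  { apply Rle_trans with (M * (eps / (2 * M))).
    - apply Rmult_le_compat_l; [lra|apply Rmin_r].
    - right; field; lra. }
  assert (T2 : Cmod B * Cmod kappa * Cmod (E' - E - E * dd)%C <= eps / 2 * s).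
  { apply Rle_trans with (M * (eta * s)).
    - apply Rmult_le_compat; [nra|apply Cmod_ge_0|unfold M; lra|exact H2].
    - rewrite <- Rmult_assoc; apply Rmult_le_compat_r; assumption. }
  lra. }
split.
- cbv beta; fold E E'; fold z z'.
  match goal with |- Rabs ?a <= _ =>
    replace a with (Re (F z' - F z - D * dd)%C) end.
  + exact (Rle_trans _ _ _ (re_le_Cmod _) Hmain).
  + unfold dd, Re; generalize (F z') (F z) D.
    intros [f1 f2] [g1 g2] [e1 e2]; simpl; ring.
- cbv beta; fold E E'; fold z z'.
  match goal with |- Rabs ?a <= _ =>
    replace a with (Im (F z' - F z - D * dd)%C) end.
  + exact (Rle_trans _ _ _ (im_le_Cmod _) Hmain).
  + unfold dd, Im; generalize (F z') (F z) D.
    intros [f1 f2] [g1 g2] [e1 e2]; simpl; ring.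
Qed.

Lemma complex_diff_bound F z : complex_diff F z ->
  exists k delta, 0 < delta /\ 0 <= k /\
    forall w : C, Cmod (w - z)%C < delta -> Cmod (F w - F z)%C <= k * Cmod (w - z)%C.
Proof.
intros [B HB]; destruct (HB 1 Rlt_0_1) as (delta & Hd & H).
exists (Cmod B + 1), delta; split; [exact Hd|].
split; [generalize (Cmod_ge_0 B); lra|].
intros w Hw.
replace (F w - F z)%C with ((F w - F z - B * (w - z)) + B * (w - z))%C by ring.
apply Rle_trans with (1 := Cmod_triangle _ _).
rewrite Cmod_mult; specialize (H w Hw); lra.
Qed.

Lemma complex_diff_continuity F z : complex_diff F z ->
  forall eps, 0 < eps -> exists delta, 0 < delta /\
    forall w : C, Cmod (w - z)%C < delta -> Cmod (F w - F z)%C < eps.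
Proof.
intros HF eps Heps; destruct (complex_diff_bound F z HF) as (k & d & Hd & Hk & H).
exists (Rmin d (eps / (k + 1))); split.
{ apply Rmin_pos; [exact Hd|apply Rdiv_lt_0_compat; lra]. }
intros w Hw.
assert (H1 := H w (Rlt_le_trans _ _ _ Hw (Rmin_l _ _))).
assert (H2 := Rlt_le_trans _ _ _ Hw (Rmin_r _ _)).
apply (Rmult_lt_compat_l (k + 1)) in H2; [|lra].
replace ((k + 1) * (eps / (k + 1))) with eps in H2 by (field; lra).
generalize (Cmod_ge_0 (w - z)%C); lra.
Qed.

(** Cauchy's theorem is applied in the logarithmic coordinate
    [log ((z - z0) / kappa)], to the rectangle over [x, 0] of height [2 PI]. Its
    horizontal sides cancel by periodicity, so the mean over the circle of radius
    [exp x |kappa|] does not depend on [x]; it tends to [F z0] as [x] tends to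
    minus infinity. *)
Lemma mean_value_Re (F : C -> C) (z0 kappa : C) :
  disk_diff F -> Cmod z0 + Cmod kappa < 1 ->
  RInt (fun t => Re (F (z0 + kappa * polar 1 t)%C)) 0 (2 * PI)
    = 2 * PI * Re (F z0).
Proof.
intros HF Hdisk.
assert (HPI := PI_RGT_0).
set (u := fun s t => Re (F (z0 + kappa * polar (exp s) t)%C)).
set (v := fun s t => Im (F (z0 + kappa * polar (exp s) t)%C)).
assert (Hin : forall s t, s <= 0 -> Cmod (z0 + kappa * polar (exp s) t)%C < 1).
{ intros s t Hs; apply Rle_lt_trans with (1 := Cmod_triangle _ _).
  rewrite Cmod_mult, Cmod_polar by (left; apply exp_pos).
  assert (exp s <= 1).
  { rewrite <- exp_0; destruct Hs as [Hs| ->]; [|lra].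
    left; apply exp_increasing; exact Hs. }
  generalize (Cmod_ge_0 kappa) (exp_pos s); nra. }
assert (Hdiff : forall s t, s <= 0 -> complex_diff_pt u v s t).
{ intros s t Hs; apply complex_diff_exp_disk, HF, Hin, Hs. }
assert (Hex : forall s, s <= 0 -> ex_RInt (u s) 0 (2 * PI)).
{ intros s Hs; apply ex_RInt_Rcont; intros t _.
  apply complex_diff_pt_continuous with v, Hdiff, Hs. }
assert (Hconst : forall x, x <= 0 -> RInt (u x) 0 (2 * PI) = RInt (u 0) 0 (2 * PI)).
{ intros x Hx.
  assert (G := goursat_rectangle u v x 0 0 (2 * PI)
    (fun s t Hs _ => Hdiff s t (proj2 Hs)) (- x) (2 * PI)).
  unfold boundary_integral in G.
  replace (x + - x) with 0 in G by ring.
  rewrite Rplus_0_l in G.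
  rewrite (RInt_Rminus (fun t => u 0 t) (fun t => u x t)) in G by (apply Hex; lra).
  rewrite (RInt_ext _ (fun _ => 0)) in G.
  - rewrite RInt_Rconst in G.
    change (fun t => u 0 t) with (u 0) in G.
    change (fun t => u x t) with (u x) in G.
    unfold contained in G; lra.
  - intros t _; unfold v; apply Rminus_diag_eq.
    rewrite <- (Rplus_0_l (2 * PI)), polar_period; reflexivity. }
apply cond_eq; intros eps Heps.
destruct (complex_diff_continuity F z0) with (eps := eps / (4 * PI))
  as (delta & Hd & H).
{ apply HF; generalize (Cmod_ge_0 kappa); lra. }
{ apply Rdiv_lt_0_compat; lra. }
assert (Hk1 : 0 < Cmod kappa + 1) by (generalize (Cmod_ge_0 kappa); lra).
set (r := Rmin 1 (delta / (Cmod kappa + 1))).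
assert (Hr : 0 < r) by (apply Rmin_pos; [lra|apply Rdiv_lt_0_compat; assumption]).
assert (Hr1 : r <= 1) by apply Rmin_l.
assert (Hr2 : Cmod kappa * r < delta).
{ apply Rlt_le_trans with ((Cmod kappa + 1) * r); [lra|].
  apply Rle_trans with ((Cmod kappa + 1) * (delta / (Cmod kappa + 1))).
  - apply Rmult_le_compat_l; [lra|apply Rmin_r].
  - right; field; lra. }
assert (Hlr : ln r <= 0) by (rewrite <- ln_1; apply ln_le; assumption).
replace (RInt (fun t => Re (F (z0 + kappa * polar 1 t)%C)) 0 (2 * PI))
  with (RInt (u (ln r)) 0 (2 * PI)).
2: { rewrite (Hconst _ Hlr); unfold u; rewrite exp_0; reflexivity. }
replace (2 * PI * Re (F z0)) with (RInt (fun _ => Re (F z0)) 0 (2 * PI))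
  by (rewrite RInt_Rconst, Rminus_0_r; reflexivity).
rewrite <- RInt_Rminus; [|apply Hex, Hlr|apply ex_RInt_const].
apply Rle_lt_trans with ((2 * PI - 0) * (eps / (4 * PI))).
- apply abs_RInt_le_const; [lra| |].
  + apply ex_RInt_Rminus; [apply Hex, Hlr|apply ex_RInt_const].
  + intros t _; unfold u; rewrite exp_ln by exact Hr.
    set (w := (z0 + kappa * polar r t)%C).
    change (Re (F w) - Re (F z0)) with (Re (F w - F z0)%C).
    apply Rle_trans with (1 := re_le_Cmod _); left; apply H.
    unfold w.
    replace (z0 + kappa * polar r t - z0)%C with (kappa * polar r t)%C by ring.
    rewrite Cmod_mult, Cmod_polar by lra; exact Hr2.
- replace ((2 * PI - 0) * (eps / (4 * PI))) with (eps / 2) by (field; lra); lra.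
Qed.

(** * Subharmonic functions and the maximum principle *)

Definition disk_continuous (Phi : C -> R) : Prop :=
  forall z, Cmod z < 1 -> forall eps, 0 < eps -> exists delta, 0 < delta /\
    forall w : C, Cmod (w - z)%C < delta -> Rabs (Phi w - Phi z) < eps.

(** The circle is parametrized from the point [z0 + kappa] on, so that its point
    of parameter [PI] can be placed anywhere by the choice of [kappa]. *)
Definition subharmonic (Phi : C -> R) : Prop :=
  disk_continuous Phi /\
  forall z0 kappa : C, Cmod z0 + Cmod kappa < 1 ->
    2 * PI * Phi z0 <= RInt (fun t => Phi (z0 + kappa * polar 1 t)%C) 0 (2 * PI).

Lemma lipschitz_of_derive (g dg : R -> R) s t :
  (forall x, is_derive g x (dg x)) -> (forall x, Rabs (dg x) <= 1) ->
  Rabs (g t - g s) <= Rabs (t - s).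
Proof.
intros Hd Hb.
destruct (MVT_gen g s t dg) as [c [_ E]].
- intros x _; apply Hd.
- intros x _; apply continuity_pt_filterlim,
    (ex_derive_continuous (K := R_AbsRing) (V := R_NormedModule)).
  exists (dg x); apply Hd.
- rewrite E, Rabs_mult; generalize (Hb c) (Rabs_pos (t - s)); nra.
Qed.

Lemma polar_lipschitz r s r' s' : 0 <= r ->
  Cmod (polar r' s' - polar r s)%C <= Rabs (r' - r) + 2 * r * Rabs (s' - s).
Proof.
intros Hr.
assert (Hc : Rabs (cos s' - cos s) <= Rabs (s' - s)).
{ apply lipschitz_of_derive with (fun x => - sin x).
  - intros x; auto_derive; [exact I|ring].
  - intros x; rewrite Rabs_Ropp; apply Rabs_le; generalize (SIN_bound x); lra. }
assert (Hs : Rabs (sin s' - sin s) <= Rabs (s' - s)).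
{ apply lipschitz_of_derive with cos.
  - intros x; auto_derive; [exact I|ring].
  - intros x; apply Rabs_le; generalize (COS_bound x); lra. }
replace (polar r' s' - polar r s)%C with
  ((r' - r)%R * polar 1 s' + r * (cos s' - cos s, sin s' - sin s)%R)%C
  by (unfold polar, Cminus, Cplus, Copp, Cmult, RtoC; simpl; f_equal; ring).
apply Rle_trans with (1 := Cmod_triangle _ _).
rewrite !Cmod_mult, Cmod_polar, !Cmod_R, (Rabs_pos_eq r) by lra.
generalize (Cmod_le_abs (cos s' - cos s) (sin s' - sin s)); nra.
Qed.

Lemma in_disk z0 kappa t : Cmod z0 + Cmod kappa < 1 ->
  Cmod (z0 + kappa * polar 1 t)%C < 1.
Proof.
intros H; apply Rle_lt_trans with (1 := Cmod_triangle _ _).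
rewrite Cmod_mult, Cmod_polar by lra; lra.
Qed.

Lemma circle_continuous Phi z0 kappa : disk_continuous Phi ->
  Cmod z0 + Cmod kappa < 1 ->
  forall t, continuous (fun t => Phi (z0 + kappa * polar 1 t)%C) t.
Proof.
intros HPhi Hd t; apply continuity_pt_filterlim; intros eps Heps.
destruct (HPhi _ (in_disk z0 kappa t Hd) eps Heps) as (delta & Hdelta & H).
assert (Hk := Cmod_ge_0 kappa).
exists (delta / (2 * (Cmod kappa + 1))); split; [apply Rdiv_lt_0_compat; lra|].
intros s [_ Hs]; simpl in *; unfold Rdist in *; apply H.
replace (z0 + kappa * polar 1 s - (z0 + kappa * polar 1 t))%C
  with (kappa * (polar 1 s - polar 1 t))%C by ring.
rewrite Cmod_mult.
assert (L := polar_lipschitz 1 t 1 s ltac:(lra)).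
rewrite Rminus_eq_0, Rabs_R0 in L.
apply (Rmult_lt_compat_l (2 * (Cmod kappa + 1))) in Hs; [|lra].
replace (2 * (Cmod kappa + 1) * (delta / (2 * (Cmod kappa + 1)))) with delta in Hs
  by (field; lra).
apply (Rmult_le_compat_l (Cmod kappa)) in L; [|exact Hk].
generalize (Rabs_pos (s - t)); lra.
Qed.

Lemma circle_ex_RInt Phi z0 kappa a b : disk_continuous Phi ->
  Cmod z0 + Cmod kappa < 1 ->
  ex_RInt (fun t => Phi (z0 + kappa * polar 1 t)%C) a b.
Proof.
intros HPhi Hd; apply ex_RInt_Rcont; intros t _.
apply circle_continuous; assumption.
Qed.

Lemma Cmod_reverse_triangle (x y : C) : Rabs (Cmod x - Cmod y) <= Cmod (x - y)%C.
Proof.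
assert (T1 := Cmod_triangle (x - y) y); assert (T2 := Cmod_triangle (y - x) x).
replace (x - y + y)%C with x in T1 by ring.
replace (y - x + x)%C with y in T2 by ring.
replace (y - x)%C with (- (x - y))%C in T2 by ring.
rewrite Cmod_opp in T2; apply Rabs_le; lra.
Qed.

Lemma disk_continuous_Cmod_power F p : 0 < p ->
  disk_diff F ->
  disk_continuous (fun z => rpow (Cmod (F z)) p).
Proof.
intros Hp HF z Hz eps Heps.
assert (Hc := rpow_abs_continuous p Hp (Cmod (F z))).
apply continuity_pt_filterlim in Hc.
destruct (Hc eps Heps) as [eta [Heta H]].
destruct (complex_diff_continuity F z (HF z Hz) eta Heta) as (delta & Hd & HC).
exists delta; split; [exact Hd|].
intros w Hw; specialize (HC w Hw).
destruct (Req_dec (Cmod (F w)) (Cmod (F z))) as [E|E].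
{ rewrite E, Rminus_eq_0, Rabs_R0; exact Heps. }
specialize (H (Cmod (F w))); simpl in H; unfold Rdist in H.
rewrite !(Rabs_pos_eq (Cmod _)) in H by apply Cmod_ge_0; apply H; split.
- split; [exact I|auto].
- apply Rle_lt_trans with (1 := Cmod_reverse_triangle _ _); exact HC.
Qed.

Lemma complex_diff_scale (e : C) F z : complex_diff F z ->
  complex_diff (fun w => (e * F w)%C) z.
Proof.
intros [B HB]; exists (e * B)%C; intros eps Heps.
assert (He := Cmod_ge_0 e).
destruct (HB (eps / (Cmod e + 1))) as (delta & Hd & H).
{ apply Rdiv_lt_0_compat; lra. }
exists delta; split; [exact Hd|].
intros w Hw; specialize (H w Hw).
replace (e * F w - e * F z - e * B * (w - z))%C
  with (e * (F w - F z - B * (w - z)))%C by ring.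
rewrite Cmod_mult.
apply (Rmult_le_compat_l (Cmod e + 1)) in H; [|lra].
replace ((Cmod e + 1) * (eps / (Cmod e + 1) * Cmod (w - z)%C))
  with (eps * Cmod (w - z)%C) in H by (field; lra).
generalize (Cmod_ge_0 (F w - F z - B * (w - z))%C); lra.
Qed.

(** The tangent to [x |-> x ^ p] at [A = |F z0|], composed with the mean value
    property of [Re (e F)], where [e] rotates [F z0] onto [A]. *)
Lemma subharmonic_Cmod_power F p : 1 <= p ->
  disk_diff F ->
  subharmonic (fun z => rpow (Cmod (F z)) p).
Proof.
intros Hp HF.
assert (HPhi := disk_continuous_Cmod_power F p ltac:(lra) HF).
split; [exact HPhi|].
intros z0 kappa Hd; assert (HPI := PI_RGT_0).
destruct (Cmod_ge_0 (F z0)) as [HA|HA].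
2: { rewrite <- HA, rpow_0, Rmult_0_r.
  apply RInt_ge_0; [lra| |intros; apply rpow_nonneg].
  exact (circle_ex_RInt _ z0 kappa 0 (2 * PI) HPhi Hd). }
set (A := Cmod (F z0)) in *.
set (e := (Cconj (F z0) / A)%C).
assert (HA0 : RtoC A <> 0) by (intros E; apply RtoC_inj in E; lra).
assert (He : Cmod e = 1).
{ unfold e; rewrite Cmod_div, Cmod_conj, Cmod_R, Rabs_pos_eq by (exact HA0 || lra).
  fold A; field; lra. }
assert (HG : disk_diff (fun w => (e * F w)%C)).
{ intros z Hz; apply complex_diff_scale, HF, Hz. }
assert (M := mean_value_Re _ z0 kappa HG Hd); cbv beta in M.
replace (Re (e * F z0)%C) with A in M.
2: { assert (E : (e * F z0 = A)%C).
  { transitivity ((F z0 * Cconj (F z0)) / A)%C; [unfold e; field; exact HA0|].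
    rewrite <- Cmod2_conj; fold A.
    replace (A ^ 2) with (A * A) by ring; rewrite RtoC_mult; field; exact HA0. }
  rewrite E; reflexivity. }
assert (HR : disk_continuous (fun z => Re (e * F z)%C)).
{ intros z Hz eps Heps.
  destruct (complex_diff_continuity _ z (HG z Hz) eps Heps) as (delta & Hdelta & H).
  exists delta; split; [exact Hdelta|]; intros w Hw.
  apply Rle_lt_trans with (2 := H w Hw).
  change (Re (e * F w)%C - Re (e * F z)%C) with (Re (e * F w - e * F z)%C).
  apply re_le_Cmod. }
set (k := p * (rpow A p / A)).
assert (Hk : 0 <= k).
{ apply Rmult_le_pos; [lra|apply Rdiv_le_0_compat; [apply rpow_nonneg|exact HA]]. }
set (g := fun t => Re (e * F (z0 + kappa * polar 1 t))%C) in *.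
assert (Hg : ex_RInt g 0 (2 * PI))
  by (exact (circle_ex_RInt _ z0 kappa 0 (2 * PI) HR Hd)).
assert (Hkg : ex_RInt (fun t => k * g t) 0 (2 * PI))
  by (exact (ex_RInt_scal (V := R_NormedModule) g 0 (2 * PI) k Hg)).
assert (EI : 2 * PI * rpow A p =
  RInt (fun t => (rpow A p - k * A) + k * g t) 0 (2 * PI)).
{ rewrite (RInt_Rplus (fun _ => rpow A p - k * A)), RInt_Rconst, RInt_Rscal, M
    by (assumption || apply ex_RInt_const); ring. }
rewrite EI.
apply RInt_le; [lra| | |].
- apply (ex_RInt_plus (V := R_NormedModule) (fun _ => rpow A p - k * A));
    [apply ex_RInt_const|exact Hkg].
- exact (circle_ex_RInt _ z0 kappa 0 (2 * PI) HPhi Hd).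
- intros t _; unfold g; set (w := (z0 + kappa * polar 1 t)%C).
  apply Rle_trans with (2 := rpow_tangent (Cmod (F w)) A p Hp (Cmod_ge_0 _) HA).
  fold k.
  assert (Re (e * F w)%C <= Cmod (F w)); [|nra].
  apply Rle_trans with (1 := Rle_abs _), Rle_trans with (1 := re_le_Cmod _).
  rewrite Cmod_mult, He; lra.
Qed.

Lemma subharmonic_plus Phi Psi : subharmonic Phi -> subharmonic Psi ->
  subharmonic (fun z => Phi z + Psi z).
Proof.
intros [C1 S1] [C2 S2]; split.
- intros z Hz eps Heps.
  destruct (C1 z Hz (eps / 2)) as (d1 & Hd1 & H1); [lra|].
  destruct (C2 z Hz (eps / 2)) as (d2 & Hd2 & H2); [lra|].
  exists (Rmin d1 d2); split; [apply Rmin_pos; assumption|].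
  intros w Hw.
  specialize (H1 w (Rlt_le_trans _ _ _ Hw (Rmin_l _ _))).
  specialize (H2 w (Rlt_le_trans _ _ _ Hw (Rmin_r _ _))).
  replace (Phi w + Psi w - (Phi z + Psi z))
    with ((Phi w - Phi z) + (Psi w - Psi z)) by ring.
  apply Rle_lt_trans with (1 := Rabs_triang _ _); lra.
- intros z0 kappa Hd.
  rewrite (RInt_Rplus (fun t => Phi (z0 + kappa * polar 1 t)%C))
    by (apply circle_ex_RInt; assumption).
  specialize (S1 z0 kappa Hd); specialize (S2 z0 kappa Hd); lra.
Qed.

Lemma subharmonic_rotate Phi a : Cmod a = 1 -> subharmonic Phi ->
  subharmonic (fun z => Phi (a * z)%C).
Proof.
intros Ha [HC HS]; split.
- intros z Hz eps Heps.
  destruct (HC (a * z)%C) with (eps := eps) as (delta & Hd & H);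
    [rewrite Cmod_mult, Ha; lra|exact Heps|].
  exists delta; split; [exact Hd|]; intros w Hw; apply H.
  replace (a * w - a * z)%C with (a * (w - z))%C by ring.
  rewrite Cmod_mult, Ha; lra.
- intros z0 kappa Hd.
  apply Rle_trans with (1 := HS (a * z0)%C (a * kappa)%C
    ltac:(rewrite !Cmod_mult, Ha; lra)).
  right; apply RInt_ext; intros t _; f_equal; ring.
Qed.

Lemma RInt_pos_of_pos_point (g : R -> R) a b c : a < c < b ->
  (forall t, continuous g t) -> (forall t, a <= t <= b -> 0 <= g t) -> 0 < g c ->
  0 < RInt g a b.
Proof.
intros Hc Hg Hpos Hgc.
assert (Hex : forall x y, ex_RInt g x y) by (intros; apply ex_RInt_Rcont; auto).
assert (Hcont := Hg c); apply continuity_pt_filterlim in Hcont.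
destruct (Hcont (g c) Hgc) as [delta [Hd H]].
set (e := Rmin delta (b - c)).
assert (He : 0 < e) by (apply Rmin_pos; lra).
assert (He1 : e <= delta) by apply Rmin_l.
assert (He2 : e <= b - c) by apply Rmin_r.
rewrite (RInt_RChasles g a c b), (RInt_RChasles g c (c + e) b) by apply Hex.
assert (I1 : 0 <= RInt g a c)
  by (apply RInt_ge_0; [lra|apply Hex|intros; apply Hpos; lra]).
assert (I2 : 0 <= RInt g (c + e) b)
  by (apply RInt_ge_0; [lra|apply Hex|intros; apply Hpos; lra]).
assert (I3 : 0 < RInt g c (c + e)); [|lra].
apply RInt_gt_0; [lra| |intros; apply Hg].
intros x Hx; specialize (H x); simpl in H; unfold Rdist in H.
assert (Hlt : Rabs (g x - g c) < g c).
{ apply H; repeat split; [lra|rewrite Rabs_pos_eq; lra]. }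
apply Rabs_def2 in Hlt; lra.
Qed.

(** Without a maximum every value is exceeded by another one; bounding [phi]
    strictly by one of its values passes from quarters to the whole rectangle,
    where it is absurd. *)
Lemma maximum_on_rectangle (phi : R -> R -> R) a W c H : 0 <= W -> 0 <= H ->
  (forall x y, a <= x <= a + W -> c <= y <= c + H -> forall eps, 0 < eps ->
     exists delta, 0 < delta /\ forall x' y',
       Rabs (x' - x) < delta -> Rabs (y' - y) < delta ->
       Rabs (phi x' y' - phi x y) < eps) ->
  exists x0 y0, (a <= x0 <= a + W /\ c <= y0 <= c + H) /\
    forall x y, a <= x <= a + W -> c <= y <= c + H -> phi x y <= phi x0 y0.
Proof.
intros HW HH Hcont; apply NNPP; intros Hno.
assert (Hup : forall x y, a <= x <= a + W -> c <= y <= c + H ->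
  exists x1 y1, (a <= x1 <= a + W /\ c <= y1 <= c + H) /\ phi x y < phi x1 y1).
{ intros x y Hx Hy; apply NNPP; intros Hn; apply Hno; exists x, y.
  split; [auto|]; intros x1 y1 Hx1 Hy1; apply Rnot_lt_le; intros Hlt.
  apply Hn; exists x1, y1; auto. }
assert (Hall : exists s,
  (exists x1 y1, (a <= x1 <= a + W /\ c <= y1 <= c + H) /\ s = phi x1 y1) /\
  forall x y, a <= x <= a + W -> c <= y <= c + H -> phi x y < s).
{ set (attained := fun s => exists x1 y1,
    (a <= x1 <= a + W /\ c <= y1 <= c + H) /\ s = phi x1 y1).
  assert (Hmax : forall s t, attained s -> attained t -> attained (Rmax s t)).
  { intros s t; apply Rmax_case; auto. }
  destruct (quadrisection_induction (fun x y w h => exists s, attained s /\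
    forall x' y', x <= x' <= x + w -> y <= y' <= y + h ->
      a <= x' <= a + W -> c <= y' <= c + H -> phi x' y' < s))
    with (a := a) (c := c) (W := W) (H := H) as (s & Hs & Hlt); auto.
  - intros x y w h (s1 & A1 & H1) (s2 & A2 & H2) (s3 & A3 & H3) (s4 & A4 & H4).
    exists (Rmax (Rmax s1 s2) (Rmax s3 s4)); split; [auto|].
    assert (M1 := Rmax_l s1 s2); assert (M2 := Rmax_r s1 s2).
    assert (M3 := Rmax_l s3 s4); assert (M4 := Rmax_r s3 s4).
    assert (M5 := Rmax_l (Rmax s1 s2) (Rmax s3 s4)).
    assert (M6 := Rmax_r (Rmax s1 s2) (Rmax s3 s4)).
    intros x' y' Hx Hy Hx' Hy'.
    destruct (Rle_dec x' (x + w / 2)); destruct (Rle_dec y' (y + h / 2)).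
    + specialize (H1 x' y' ltac:(lra) ltac:(lra) Hx' Hy'); lra.
    + specialize (H3 x' y' ltac:(lra) ltac:(lra) Hx' Hy'); lra.
    + specialize (H2 x' y' ltac:(lra) ltac:(lra) Hx' Hy'); lra.
    + specialize (H4 x' y' ltac:(lra) ltac:(lra) Hx' Hy'); lra.
  - intros x y Hx Hy; destruct (Hup x y Hx Hy) as (x1 & y1 & Hin & Hlt).
    destruct (Hcont x y Hx Hy (phi x1 y1 - phi x y)) as (delta & Hd & Hdelta); [lra|].
    exists delta; split; [exact Hd|].
    intros x0 y0 w h Hw Hh Hx0 Hy0; exists (phi x1 y1); split.
    { exists x1, y1; auto. }
    intros x' y' Hx' Hy' _ _.
    assert (Hn : Rabs (phi x' y' - phi x y) < phi x1 y1 - phi x y)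
      by (apply Hdelta; apply Rabs_def1; lra).
    apply Rabs_def2 in Hn; lra.
  - exists s; split; [exact Hs|auto]. }
destruct Hall as (s & (x1 & y1 & [Hx1 Hy1] & ->) & Hlt).
specialize (Hlt x1 y1 Hx1 Hy1); lra.
Qed.

Lemma polar_surjective (z : C) : exists t, 0 <= t <= 2 * PI /\ z = polar (Cmod z) t.
Proof.
assert (HPI := PI_RGT_0).
destruct (Cmod_ge_0 z) as [Hr|Hr].
2: { exists 0; split; [lra|]; rewrite (Cmod_eq_0 z), Cmod_0 by auto.
  unfold polar; rewrite !Rmult_0_l; reflexivity. }
set (r := Cmod z) in *.
destruct z as [x y].
assert (Hxy : x ^ 2 + y ^ 2 = r ^ 2).
{ unfold r, Cmod; rewrite pow2_sqrt; [reflexivity|simpl; nra]. }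
assert (Hx : -1 <= x / r <= 1).
{ assert (Hx2 : Rabs x <= Rabs r) by (apply Rsqr_le_abs_0; unfold Rsqr; nra).
  rewrite (Rabs_pos_eq r) in Hx2 by lra.
  assert (B1 := Rle_abs x); assert (B2 := Rle_abs (- x)); rewrite Rabs_Ropp in B2.
  split; apply Rmult_le_reg_r with r; try exact Hr;
    unfold Rdiv; rewrite Rmult_assoc, Rinv_l; lra. }
assert (Hsin : sin (acos (x / r)) = Rabs y / r).
{ rewrite sin_acos by exact Hx.
  replace (1 - (x / r)²) with ((Rabs y / r)²).
  - apply sqrt_Rsqr, Rdiv_le_0_compat; [apply Rabs_pos|exact Hr].
  - unfold Rsqr; replace (Rabs y / r * (Rabs y / r)) with (Rabs y ^ 2 / r ^ 2)
      by (field; lra).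
    rewrite pow2_abs; replace (y ^ 2) with (r ^ 2 - x ^ 2) by lra; field; lra. }
assert (Hb := acos_bound (x / r)).
destruct (Rle_dec 0 y) as [Hy|Hy].
- exists (acos (x / r)); split; [lra|].
  unfold polar; rewrite cos_acos, Hsin, Rabs_pos_eq by assumption.
  f_equal; field; lra.
- exists (- acos (x / r) + 2 * PI); split; [lra|].
  rewrite polar_period; unfold polar.
  rewrite cos_neg, sin_neg, cos_acos, Hsin, Rabs_left by (assumption || lra).
  f_equal; field; lra.
Qed.

(** Let [z0] be a maximum point in the closed disk of radius [R]. The mean over
    the circle about [z0] that touches the boundary of this disk from inside is
    at least the maximum, so the maximum is also attained at the touching
    point, which is the value [PI] of the parameter of that circle. *)
Lemma maximum_principle Phi R z1 : subharmonic Phi -> R < 1 -> Cmod z1 <= R ->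
  exists t, 0 <= t <= 2 * PI /\ Phi z1 <= Phi (polar R t).
Proof.
intros [HC HS] HR1 Hz1; assert (HPI := PI_RGT_0).
assert (HR : 0 <= R) by (generalize (Cmod_ge_0 z1); lra).
destruct (maximum_on_rectangle (fun r t => Phi (polar r t)) 0 R 0 (2 * PI))
  as (r0 & t0 & [Hr0 Ht0] & Hmax); [lra|lra| |].
{ intros r t Hr Ht eps Heps; rewrite Rplus_0_l in Hr.
  destruct (HC (polar r t)) with (eps := eps) as (delta & Hd & H);
    [rewrite Cmod_polar; lra|exact Heps|].
  exists (delta / 3); split; [lra|]; intros r' t' Hr' Ht'; apply H.
  apply Rle_lt_trans with (1 := polar_lipschitz r t r' t' (proj1 Hr)).
  generalize (Rabs_pos (t' - t)); nra. }
rewrite !Rplus_0_l in *.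
assert (Hdisk : forall z, Cmod z <= R -> Phi z <= Phi (polar r0 t0)).
{ intros z Hz; destruct (polar_surjective z) as (t & Ht & E); rewrite E.
  apply Hmax; [split; [apply Cmod_ge_0|exact Hz]|exact Ht]. }
exists t0; split; [exact Ht0|].
apply Rle_trans with (1 := Hdisk z1 Hz1).
apply Rnot_lt_le; intros Hlt.
set (z0 := polar r0 t0) in *.
set (kappa := (- polar (R - r0) t0)%C).
assert (Hz0 : Cmod z0 = r0) by (apply Cmod_polar; lra).
assert (Hk : Cmod kappa = R - r0)
  by (unfold kappa; rewrite Cmod_opp; apply Cmod_polar; lra).
assert (Hd : Cmod z0 + Cmod kappa < 1) by lra.
set (g := fun t => Phi z0 - Phi (z0 + kappa * polar 1 t)%C).
assert (Hg : forall t, continuous g t).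
{ intros t; apply (continuous_minus (V := R_NormedModule) (fun _ => Phi z0));
    [apply continuous_const|apply circle_continuous; assumption]. }
assert (Hpos : 0 < RInt g 0 (2 * PI)).
{ apply RInt_pos_of_pos_point with PI; [lra|exact Hg| |].
  - intros t _; unfold g.
    assert (Phi (z0 + kappa * polar 1 t)%C <= Phi z0); [|lra].
    apply Hdisk, Rle_trans with (1 := Cmod_triangle _ _).
    rewrite Cmod_mult, Cmod_polar by lra; lra.
  - unfold g.
    replace (z0 + kappa * polar 1 PI)%C with (polar R t0); [lra|].
    unfold z0, kappa, polar; rewrite cos_PI, sin_PI.
    unfold Cmult, Cplus, Copp; simpl; f_equal; ring. }
unfold g in Hpos.
rewrite (RInt_Rminus (fun _ => Phi z0)), RInt_Rconst in Hpos;
  [|apply ex_RInt_const|apply circle_ex_RInt; assumption].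
specialize (HS z0 kappa Hd); lra.
Qed.

(** * Monotonicity of circle means *)

Lemma RInt_periodic_shift (k : R -> R) T a : (forall t, continuous k t) ->
  (forall t, k (t + T) = k t) -> RInt k a (a + T) = RInt k 0 T.
Proof.
intros Hk HT.
assert (Hex : forall x y, ex_RInt k x y) by (intros; apply ex_RInt_Rcont; auto).
assert (Hs : RInt k T (a + T) = RInt k 0 a).
{ assert (L := RInt_comp_lin (V := R_CompleteNormedModule) k 1 T 0 a (Hex _ _)).
  rewrite Rmult_0_r, Rplus_0_l, Rmult_1_l in L; rewrite <- L.
  apply RInt_ext; intros t _; rewrite <- (HT t).
  transitivity (1 * k (1 * t + T)); [reflexivity|].
  rewrite !Rmult_1_l; reflexivity. }
assert (E1 := RInt_RChasles k 0 a (a + T) (Hex _ _) (Hex _ _)).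
assert (E2 := RInt_RChasles k 0 T (a + T) (Hex _ _) (Hex _ _)).
lra.
Qed.

Lemma riemann_sum_error (k : R -> R) a h eta n : 0 <= h ->
  (forall t, continuous k t) ->
  (forall s t, a <= s <= a + INR (S n) * h -> s <= t <= s + h ->
     Rabs (k s - k t) <= eta) ->
  Rabs (sum_f_R0 (fun j => h * k (a + INR j * h)) n
        - RInt k a (a + INR (S n) * h)) <= INR (S n) * h * eta.
Proof.
intros Hh Hk Hosc.
assert (Hex : forall x y, ex_RInt k x y) by (intros; apply ex_RInt_Rcont; auto).
assert (Hone : forall s, a <= s <= a + INR (S n) * h ->
  Rabs (h * k s - RInt k s (s + h)) <= h * eta).
{ intros s Hs.
  assert (Ec : h * k s = RInt (fun _ => k s) s (s + h)) by (rewrite RInt_Rconst; ring).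
  rewrite Ec, <- RInt_Rminus; [|apply ex_RInt_const|apply Hex].
  replace (h * eta) with ((s + h - s) * eta) by ring.
  apply abs_RInt_le_const; [lra| |intros t Ht; apply Hosc; lra].
  apply ex_RInt_Rminus; [apply ex_RInt_const|apply Hex]. }
clear Hosc.
induction n as [|n IH].
- simpl sum_f_R0; simpl INR; rewrite Rmult_0_l, Rplus_0_r, !Rmult_1_l.
  apply Hone; simpl INR; lra.
- rewrite tech5.
  rewrite (RInt_RChasles k a (a + INR (S n) * h)) by apply Hex.
  replace (a + INR (S (S n)) * h) with (a + INR (S n) * h + h)
    by (rewrite (S_INR (S n)); ring).
  replace (INR (S (S n)) * h * eta) with (INR (S n) * h * eta + h * eta)
    by (rewrite (S_INR (S n)); ring).
  match goal with |- Rabs (?p + ?q - (?r + ?s)) <= _ =>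
    replace (p + q - (r + s)) with ((p - r) + (q - s)) by ring end.
  assert (Hn := pos_INR (S n)).
  apply Rle_trans with (1 := Rabs_triang _ _), Rplus_le_compat.
  + apply IH; intros s Hs; apply Hone; rewrite (S_INR (S n)); nra.
  + apply Hone; rewrite (S_INR (S n)); nra.
Qed.

(** The number of sample points does not depend on the position [a] of the first
    one: this uniformity is what the passage from one circle to another uses. *)
Lemma riemann_sum_uniform (k : R -> R) eps : (forall t, continuous k t) ->
  (forall t, k (t + 2 * PI) = k t) -> 0 < eps ->
  exists N, forall n a, (N <= n)%nat -> 0 <= a <= 2 * PI ->
    let h := 2 * PI / INR (S n) in
    Rabs (h * sum_f_R0 (fun j => k (a + INR j * h)) n - RInt k 0 (2 * PI)) <= eps.
Proof.
intros Hk Hper Heps; assert (HPI := PI_RGT_0).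
set (eta := eps / (2 * PI)).
assert (Heta : 0 < eta) by (apply Rdiv_lt_0_compat; lra).
(* All sample points [a + j h], and the cells of length [h] behind them, lie in
   [0, 6 PI]. *)
destruct (Heine_cor2 (f := k) (a := 0) (b := 6 * PI)
  (fun x _ => proj2 (continuity_pt_filterlim k x) (Hk x)) (mkposreal eta Heta))
  as [delta Hd].
assert (Hdpos := cond_pos delta).
destruct (archimed_cor1 (Rmin 1 delta / (2 * PI))) as [N [HN HN0]].
{ apply Rdiv_lt_0_compat; [apply Rmin_pos; lra|lra]. }
exists N; intros n a Hn Ha h.
assert (HnN : INR N <= INR (S n)) by (apply le_INR; lia).
assert (HN1 : 0 < INR N) by (apply lt_0_INR; exact HN0).
assert (Hh0 : 0 < h) by (apply Rdiv_lt_0_compat; lra).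
assert (Hh : h < Rmin 1 delta).
{ apply Rle_lt_trans with (2 * PI * / INR N).
  - apply Rmult_le_compat_l; [lra|apply Rinv_le_contravar; assumption].
  - apply (Rmult_lt_compat_l (2 * PI)) in HN; [|lra].
    replace (2 * PI * (Rmin 1 delta / (2 * PI))) with (Rmin 1 delta) in HN
      by (field; lra); exact HN. }
assert (Hm1 := Rmin_l 1 delta); assert (Hm2 := Rmin_r 1 delta).
assert (HnE : INR (S n) * h = 2 * PI) by (unfold h; field; lra).
assert (E := riemann_sum_error k a h eta n (Rlt_le _ _ Hh0) Hk).
assert (HPI1 := PI2_1).
rewrite HnE, RInt_periodic_shift in E by assumption.
replace (2 * PI * eta) with eps in E by (unfold eta; field; lra).
rewrite scal_sum.
rewrite (sum_eq _ (fun j => h * k (a + INR j * h))) by (intros; ring).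
apply E; intros s t Hs Ht; left; apply Hd; try lra.
rewrite Rabs_minus_sym, Rabs_pos_eq; lra.
Qed.

Lemma subharmonic_sum (Phi : nat -> C -> R) n :
  (forall j, subharmonic (Phi j)) ->
  subharmonic (fun z => sum_f_R0 (fun j => Phi j z) n).
Proof.
intros H; induction n as [|n IH]; simpl.
- apply H.
- apply (subharmonic_plus (fun z => sum_f_R0 (fun j => Phi j z) n)); auto.
Qed.

Lemma polar_eq_circle r t : polar r t = (0 + RtoC r * polar 1 t)%C.
Proof. unfold polar, Cplus, Cmult, RtoC; simpl; f_equal; ring. Qed.

Lemma circle_mean_continuous Phi r : disk_continuous Phi -> 0 <= r < 1 ->
  forall t, continuous (fun t => Phi (polar r t)) t.
Proof.
intros HPhi Hr t.
apply continuous_ext with (fun t => Phi (0 + RtoC r * polar 1 t)%C).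
{ intros s; rewrite (polar_eq_circle r s); reflexivity. }
apply circle_continuous; [exact HPhi|].
rewrite Cmod_0, Cmod_R, Rabs_pos_eq; lra.
Qed.

(** The Riemann sum of [Phi] over equidistant points of a circle is, as a
    function of the first of these points, a sum of rotated copies of [Phi] and
    hence subharmonic. The maximum principle moves this point to the larger
    circle without decreasing the sum, and there the sum approximates the mean
    wherever the point lies. *)
Lemma circle_mean_nondecreasing Phi r R : subharmonic Phi -> 0 <= r <= R -> R < 1 ->
  RInt (fun t => Phi (polar r t)) 0 (2 * PI)
    <= RInt (fun t => Phi (polar R t)) 0 (2 * PI).
Proof.
intros HPhi Hr HR; assert (HPI := PI_RGT_0).
assert (Hcont : forall s, 0 <= s < 1 ->
  forall t, continuous (fun t => Phi (polar s t)) t).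
{ intros s Hs; apply circle_mean_continuous; [apply HPhi|exact Hs]. }
assert (Hper : forall s t, Phi (polar s (t + 2 * PI)) = Phi (polar s t)).
{ intros s t; rewrite polar_period; reflexivity. }
apply le_epsilon; intros eps Heps.
destruct (riemann_sum_uniform (fun t => Phi (polar r t)) (eps / 2)
  (Hcont r ltac:(lra)) (Hper r)) as [N1 H1]; [lra|].
destruct (riemann_sum_uniform (fun t => Phi (polar R t)) (eps / 2)
  (Hcont R ltac:(lra)) (Hper R)) as [N2 H2]; [lra|].
set (n := (N1 + N2)%nat).
set (h := 2 * PI / INR (S n)).
assert (Hh : 0 < h) by (apply Rdiv_lt_0_compat; [lra|apply lt_0_INR; lia]).
set (Sigma := fun z => sum_f_R0 (fun j => Phi (polar 1 (INR j * h) * z)%C) n).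
assert (HS : subharmonic Sigma).
{ apply (subharmonic_sum (fun j z => Phi (polar 1 (INR j * h) * z)%C)).
  intros j; apply subharmonic_rotate; [apply Cmod_polar; lra|exact HPhi]. }
destruct (maximum_principle Sigma R (polar r 0) HS HR) as (t & Ht & Hle).
{ rewrite Cmod_polar; lra. }
assert (HSig : forall s a, Sigma (polar s a)
  = sum_f_R0 (fun j => Phi (polar s (a + INR j * h))) n).
{ intros s a; apply sum_eq; intros j _; rewrite polar_mult, Rmult_1_l, Rplus_comm.
  reflexivity. }
rewrite !HSig in Hle.
specialize (H1 n 0 ltac:(lia) ltac:(lra)); specialize (H2 n t ltac:(lia) Ht).
cbv beta zeta in H1, H2; fold h in H1, H2.
apply Rabs_le_between in H1; apply Rabs_le_between in H2.
apply (Rmult_le_compat_l h) in Hle; lra.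
Qed.

(** * The weak parallelogram law on a circle *)

Lemma Cmod_sqr (z : C) : Cmod z ^ 2 = fst z ^ 2 + snd z ^ 2.
Proof.
unfold Cmod; apply pow2_sqrt.
generalize (pow2_ge_0 (fst z)) (pow2_ge_0 (snd z)); lra.
Qed.

Lemma Cmod_parallelogram (w e : C) :
  Cmod (w + e)%C ^ 2 + Cmod (w - e)%C ^ 2 = 2 * (Cmod w ^ 2 + Cmod e ^ 2).
Proof. rewrite !Cmod_sqr; destruct w, e; simpl; ring. Qed.

Lemma rpow_sqr x p : 0 <= x -> rpow x p = rpow (x ^ 2) (p / 2).
Proof. intros Hx; rewrite <- rpow_2, rpow_rpow by exact Hx; f_equal; field. Qed.

(** The square moduli of [w + e] and [w - e] have the mean
    [|w| ^ 2 + |e| ^ 2], and the power [p / 2] is concave and subadditive. *)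
Lemma clarkson_pointwise p (w e : C) : 0 < p <= 2 ->
  rpow (Cmod (w + e)%C) p + rpow (Cmod (w - e)%C) p
    <= 2 * (rpow (Cmod w) p + rpow (Cmod e) p).
Proof.
intros Hp; assert (Ha : 0 < p / 2 <= 1) by lra.
rewrite !(fun z => rpow_sqr (Cmod z) p (Cmod_ge_0 z)).
assert (C1 := rpow_midpoint_concave (Cmod (w + e)%C ^ 2) (Cmod (w - e)%C ^ 2) (p / 2) Ha
  (pow2_ge_0 _) (pow2_ge_0 _)).
assert (C2 := rpow_subadditive (Cmod w ^ 2) (Cmod e ^ 2) (p / 2) Ha
  (pow2_ge_0 _) (pow2_ge_0 _)).
rewrite Cmod_parallelogram in C1.
replace (2 * (Cmod w ^ 2 + Cmod e ^ 2) / 2) with (Cmod w ^ 2 + Cmod e ^ 2) in C1 by field.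
lra.
Qed.

Lemma two_point_pointwise p (w e : C) : 2 <= p ->
  (rpow (Cmod (w + e)%C) p + rpow (Cmod (w - e)%C) p) / 2
    <= rpow (Cmod w ^ 2 + (p - 1) * Cmod e ^ 2) (p / 2).
Proof.
intros Hp.
assert (Hw := Cmod_ge_0 w); assert (He := Cmod_ge_0 e).
apply Rle_trans with (2 := two_point p (Cmod w) (Cmod e) Hp Hw He).
set (m := Cmod w ^ 2 + Cmod e ^ 2).
set (s := Cmod (w + e)%C ^ 2 - m).
assert (Hpar := Cmod_parallelogram w e).
assert (T1 := Cmod_triangle w e); assert (T2 := Cmod_triangle w (- e)).
rewrite Cmod_opp in T2; change (w + - e)%C with (w - e)%C in T2.
assert (P1 := Cmod_ge_0 (w + e)%C); assert (P2 := Cmod_ge_0 (w - e)%C).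
assert (Q1 : Cmod (w + e)%C ^ 2 <= (Cmod w + Cmod e) ^ 2) by (apply pow_incr; lra).
assert (Q2 : Cmod (w - e)%C ^ 2 <= (Cmod w + Cmod e) ^ 2) by (apply pow_incr; lra).
rewrite (rpow_sqr (Cmod (w + e)%C)), (rpow_sqr (Cmod (w - e)%C)),
  (rpow_sqr (Cmod w + Cmod e)), (rpow_sqr (Rabs (Cmod w - Cmod e)))
  by (lra || apply Rabs_pos).
rewrite pow2_abs.
replace (Cmod (w + e)%C ^ 2) with (m + s) by (unfold s; ring).
replace (Cmod (w - e)%C ^ 2) with (m - s) by (unfold s, m; lra).
replace ((Cmod w + Cmod e) ^ 2) with (m + 2 * Cmod w * Cmod e) by (unfold m; ring).
replace ((Cmod w - Cmod e) ^ 2) with (m - 2 * Cmod w * Cmod e) by (unfold m; ring).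
assert (S := rpow_symmetric_spread (p / 2) m s (2 * Cmod w * Cmod e)).
assert (Hs : Rabs s <= 2 * Cmod w * Cmod e).
{ replace ((Cmod w + Cmod e) ^ 2) with (m + 2 * Cmod w * Cmod e) in Q1, Q2
    by (unfold m; ring).
  apply Rabs_le; unfold s, m in *; split; lra. }
assert (HS : 2 * Cmod w * Cmod e <= m)
  by (generalize (pow2_ge_0 (Cmod w - Cmod e)); unfold m; lra).
specialize (S ltac:(lra) Hs HS); lra.
Qed.

Lemma circle_power_continuous F p r : 0 < p -> disk_diff F -> 0 <= r < 1 ->
  forall t, continuous (fun t => rpow (Cmod (F (polar r t))) p) t.
Proof.
intros Hp HF Hr.
exact (circle_mean_continuous _ r (disk_continuous_Cmod_power F p Hp HF) Hr).
Qed.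

(** Two functions on the left suffice for the parallelogram laws; a bound for a
    single function is the case [G = F]. *)
Lemma hardy_mean_linear_le p F G U V a b c r : 0 < p -> 0 <= r < 1 ->
  disk_diff F -> disk_diff G -> disk_diff U -> disk_diff V ->
  (forall z, Cmod z < 1 -> rpow (Cmod (F z)) p + rpow (Cmod (G z)) p
     <= a * rpow (Cmod (U z)) p + b * rpow (Cmod (V z)) p + c) ->
  hardy_mean p F r + hardy_mean p G r
    <= a * hardy_mean p U r + b * hardy_mean p V r + c.
Proof.
intros Hp Hr HF HG HU HV H; assert (HPI := PI_RGT_0).
unfold hardy_mean.
set (k := fun (W : C -> C) t => rpow (Cmod (W (polar r t))) p).
change (/ (2 * PI) * RInt (k F) 0 (2 * PI) + / (2 * PI) * RInt (k G) 0 (2 * PI)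
  <= a * (/ (2 * PI) * RInt (k U) 0 (2 * PI))
     + b * (/ (2 * PI) * RInt (k V) 0 (2 * PI)) + c).
assert (Hk : forall W, disk_diff W -> ex_RInt (k W) 0 (2 * PI)).
{ intros W HW; apply ex_RInt_Rcont; intros t _.
  apply circle_power_continuous; assumption. }
assert (Hplus : forall g1 g2 : R -> R, ex_RInt g1 0 (2 * PI) -> ex_RInt g2 0 (2 * PI) ->
  ex_RInt (fun t => g1 t + g2 t) 0 (2 * PI)).
{ intros g1 g2; exact (ex_RInt_plus (V := R_NormedModule) g1 g2 0 (2 * PI)). }
assert (Hscal : forall (x : R) (g : R -> R), ex_RInt g 0 (2 * PI) ->
  ex_RInt (fun t => x * g t) 0 (2 * PI)).
{ intros x g; exact (ex_RInt_scal (V := R_NormedModule) g 0 (2 * PI) x). }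
assert (I : RInt (fun t => k F t + k G t) 0 (2 * PI)
  <= RInt (fun t => a * k U t + b * k V t + c) 0 (2 * PI)).
{ apply RInt_le; [lra|apply Hplus; auto| |].
  - apply (Hplus (fun t => a * k U t + b * k V t) (fun _ => c)); [|apply ex_RInt_const].
    apply (Hplus (fun t => a * k U t) (fun t => b * k V t)); apply Hscal; auto.
  - intros t _; apply H; rewrite Cmod_polar; lra. }
rewrite (RInt_Rplus (k F) (k G)) in I by auto.
rewrite (RInt_Rplus (fun t => a * k U t + b * k V t) (fun _ => c)) in I;
  [|apply (Hplus (fun t => a * k U t) (fun t => b * k V t)); apply Hscal; auto
   |apply ex_RInt_const].
rewrite (RInt_Rplus (fun t => a * k U t) (fun t => b * k V t)) in I by auto.
rewrite (RInt_Rscal (k U)), (RInt_Rscal (k V)), RInt_Rconst in I by auto.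
apply (Rmult_le_compat_l (/ (2 * PI))) in I;
  [|left; apply Rinv_0_lt_compat; lra].
replace c with (/ (2 * PI) * ((2 * PI - 0) * c)) by (field; lra).
lra.
Qed.

Lemma hardy_mean_nonneg p F r : 0 < p -> disk_diff F -> 0 <= r < 1 ->
  0 <= hardy_mean p F r.
Proof.
intros Hp HF Hr; assert (HPI := PI_RGT_0).
apply Rmult_le_pos; [left; apply Rinv_0_lt_compat; lra|].
apply RInt_ge_0; [lra| |intros; apply rpow_nonneg].
apply ex_RInt_Rcont; intros t _; apply circle_power_continuous; assumption.
Qed.

Lemma hardy_mean_nondecreasing p F r1 r2 : 1 <= p -> disk_diff F ->
  0 <= r1 <= r2 -> r2 < 1 -> hardy_mean p F r1 <= hardy_mean p F r2.
Proof.
intros Hp HF Hr H1; assert (HPI := PI_RGT_0).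
apply Rmult_le_compat_l; [left; apply Rinv_0_lt_compat; lra|].
exact (circle_mean_nondecreasing _ r1 r2 (subharmonic_Cmod_power F p Hp HF) Hr H1).
Qed.

Lemma clarkson_mean p F G r : 0 < p <= 2 -> 0 <= r < 1 ->
  disk_diff F -> disk_diff G ->
  disk_diff (fun z => F z + G z)%C -> disk_diff (fun z => F z - G z)%C ->
  hardy_mean p (fun z => F z + G z)%C r + hardy_mean p (fun z => F z - G z)%C r
    <= 2 * (hardy_mean p F r + hardy_mean p G r).
Proof.
intros Hp Hr HF HG HS HD.
apply Rle_trans with (2 * hardy_mean p F r + 2 * hardy_mean p G r + 0); [|lra].
apply hardy_mean_linear_le; try assumption; try lra.
intros z _; generalize (clarkson_pointwise p (F z) (G z) Hp); lra.
Qed.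

(** Convexity of the power [q] at [x / alpha] and [y / beta] with weights
    proportional to [alpha] and [beta]. When [alpha] and [beta] are the [L ^ q]
    norms of [x] and [y], integration gives Minkowski's inequality. *)
Lemma rpow_sum_le_weighted q x y alpha beta : 1 <= q -> 0 <= x -> 0 <= y ->
  0 < alpha -> 0 < beta ->
  rpow (x + y) q <= rpow (alpha + beta) q *
    (alpha / (alpha + beta) * (rpow x q / rpow alpha q)
     + beta / (alpha + beta) * (rpow y q / rpow beta q)).
Proof.
intros Hq Hx Hy Ha Hb.
assert (Hdiv : forall u v, 0 <= u -> 0 < v -> rpow u q / rpow v q = rpow (u / v) q).
{ intros u v Hu Hv; assert (Hp := rpow_pos v q Hv).
  apply Rmult_eq_reg_r with (rpow v q); [|lra].
  rewrite <- rpow_mult by (lra || (apply Rdiv_le_0_compat; lra)).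
  replace (u / v * v) with u by (field; lra); field; lra. }
rewrite !Hdiv by assumption.
set (k := alpha / (alpha + beta)).
assert (Hk : 0 <= k <= 1).
{ split; [apply Rdiv_le_0_compat; lra|].
  apply Rmult_le_reg_r with (alpha + beta); [lra|].
  unfold k; field_simplify; lra. }
replace (beta / (alpha + beta)) with (1 - k) by (unfold k; field; lra).
assert (Hxa : 0 <= x / alpha) by (apply Rdiv_le_0_compat; lra).
assert (Hyb : 0 <= y / beta) by (apply Rdiv_le_0_compat; lra).
assert (Cv := rpow_convex k (x / alpha) (y / beta) q Hq Hk Hxa Hyb).
apply (Rmult_le_compat_l (rpow (alpha + beta) q)) in Cv; [|apply rpow_nonneg].
rewrite <- rpow_mult in Cv by nra.
replace ((alpha + beta) * (k * (x / alpha) + (1 - k) * (y / beta))) with (x + y) in Cv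
  by (unfold k; field; lra).
exact Cv.
Qed.

(** The space [L ^ p] is 2-uniformly smooth with constant [p - 1]: the two-point
    inequality is integrated with Minkowski's inequality in [L ^ (p / 2)], and
    the concavity of the power [2 / p] turns the mean of [p]-th powers on the
    left into the mean of squares. *)
Lemma smoothness_mean p F G r : 2 <= p -> 0 <= r < 1 ->
  disk_diff F -> disk_diff G ->
  disk_diff (fun z => F z + G z)%C -> disk_diff (fun z => F z - G z)%C ->
  rpow (hardy_mean p (fun z => F z + G z)%C r) (2 / p)
    + rpow (hardy_mean p (fun z => F z - G z)%C r) (2 / p)
    <= 2 * (rpow (hardy_mean p F r) (2 / p)
            + (p - 1) * rpow (hardy_mean p G r) (2 / p)).
Proof.
intros Hp Hr HF HG HS HD.
assert (Hp0 : 0 < p) by lra.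
assert (MF := hardy_mean_nonneg p F r Hp0 HF Hr).
assert (MG := hardy_mean_nonneg p G r Hp0 HG Hr).
assert (MS := hardy_mean_nonneg p _ r Hp0 HS Hr).
assert (MD := hardy_mean_nonneg p _ r Hp0 HD Hr).
set (mF := hardy_mean p F r) in *; set (mG := hardy_mean p G r) in *.
set (mS := hardy_mean p (fun z => F z + G z)%C r) in *.
set (mD := hardy_mean p (fun z => F z - G z)%C r) in *.
set (X := rpow mF (2 / p)); set (Y := rpow mG (2 / p)).
assert (HX : 0 <= X) by apply rpow_nonneg; assert (HY : 0 <= Y) by apply rpow_nonneg.
apply le_epsilon; intros eps Heps.
(* The summand [eps / 4] keeps both weights positive when a mean vanishes. *)
set (alpha := X + eps / 4); set (beta := (p - 1) * Y + eps / 4).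
assert (Ha : 0 < alpha) by (unfold alpha; lra).
assert (Hb : 0 < beta) by (unfold beta; nra).
assert (Hq : 1 <= p / 2) by lra.
assert (Epow : forall m, 0 <= m -> rpow (rpow m (2 / p)) (p / 2) = m).
{ intros m Hm; rewrite rpow_rpow by exact Hm.
  replace (2 / p * (p / 2)) with 1 by (field; lra); apply rpow_1, Hm. }
assert (HmF : mF <= rpow alpha (p / 2)).
{ rewrite <- (Epow mF MF); apply rpow_le; [lra|fold X; unfold alpha; lra]. }
assert (HmG : rpow (p - 1) (p / 2) * mG <= rpow beta (p / 2)).
{ rewrite <- (Epow mG MG), <- rpow_mult by (lra || apply rpow_nonneg).
  fold Y; apply rpow_le; [lra|unfold beta; nra]. }
assert (PA : 0 < rpow alpha (p / 2)) by (apply rpow_pos; exact Ha).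
assert (PB : 0 < rpow beta (p / 2)) by (apply rpow_pos; exact Hb).
assert (Pp : 0 < rpow (p - 1) (p / 2)) by (apply rpow_pos; lra).
set (T := rpow (alpha + beta) (p / 2)).
assert (HT : 0 < T) by (apply rpow_pos; lra).
set (cF := T * (alpha / (alpha + beta) / rpow alpha (p / 2))).
set (cG := T * (beta / (alpha + beta) * (rpow (p - 1) (p / 2) / rpow beta (p / 2)))).
assert (HcF : 0 <= cF).
{ apply Rmult_le_pos; [lra|]; repeat apply Rdiv_le_0_compat; lra. }
assert (Hmean : mS + mD <= (2 * cF) * mF + (2 * cG) * mG + 0).
{ apply hardy_mean_linear_le; try assumption.
  intros z _.
  assert (H1 := two_point_pointwise p (F z) (G z) Hp).
  assert (H2 := rpow_sum_le_weighted (p / 2) (Cmod (F z) ^ 2) ((p - 1) * Cmod (G z) ^ 2)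
    alpha beta Hq (pow2_ge_0 _) ltac:(generalize (pow2_ge_0 (Cmod (G z))); nra) Ha Hb).
  rewrite rpow_mult, <- !rpow_sqr in H2 by (lra || apply pow2_ge_0 || apply Cmod_ge_0).
  fold T in H2.
  replace (2 * cF * rpow (Cmod (F z)) p + 2 * cG * rpow (Cmod (G z)) p + 0)
    with (2 * (T * (alpha / (alpha + beta) * (rpow (Cmod (F z)) p / rpow alpha (p / 2)) +
      beta / (alpha + beta) * (rpow (p - 1) (p / 2) * rpow (Cmod (G z)) p / rpow beta (p / 2)))))
    by (unfold cF, cG; field; lra).
  lra. }
assert (Hfin : mS + mD <= 2 * T).
{ apply Rle_trans with (1 := Hmean).
  assert (E1 : cF * mF <= T * (alpha / (alpha + beta))).
  { apply Rle_trans with (cF * rpow alpha (p / 2)); [apply Rmult_le_compat_l; assumption|].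
    right; unfold cF; field; lra. }
  assert (E2 : cG * mG <= T * (beta / (alpha + beta))).
  { apply Rle_trans with (T * (beta / (alpha + beta)) / rpow beta (p / 2)
      * (rpow (p - 1) (p / 2) * mG)).
    - right; unfold cG; field; lra.
    - apply Rle_trans with (T * (beta / (alpha + beta)) / rpow beta (p / 2)
        * rpow beta (p / 2)).
      + apply Rmult_le_compat_l; [|exact HmG].
        apply Rdiv_le_0_compat; [|lra].
        apply Rmult_le_pos; [lra|apply Rdiv_le_0_compat; lra].
      + right; field; lra. }
  replace (2 * T) with (2 * (T * (alpha / (alpha + beta)) + T * (beta / (alpha + beta))))
    by (field; lra).
  lra. }
assert (Hs : 0 < 2 / p <= 1).
{ split; [apply Rdiv_lt_0_compat; lra|].
  apply Rmult_le_reg_r with p; [lra|].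
  replace (2 / p * p) with 2 by (field; lra); lra. }
assert (Hmid := rpow_midpoint_concave mS mD (2 / p) Hs MS MD).
assert (Hroot : rpow ((mS + mD) / 2) (2 / p) <= alpha + beta).
{ apply Rle_trans with (rpow T (2 / p)).
  - apply rpow_le; lra.
  - unfold T; rewrite rpow_rpow by lra.
    replace (p / 2 * (2 / p)) with 1 by (field; lra); rewrite rpow_1; lra. }
unfold alpha, beta in Hroot; lra.
Qed.

(** The factor of the last term in the upper weak parallelogram law with exponent
    [upper_s p], which is Clarkson's inequality for [p <= 2] and 2-uniform
    smoothness for [2 <= p]. *)
Definition parallelogram_constant (p : R) : R := if Rle_dec p 2 then 1 else p - 1.

Lemma weak_parallelogram_mean p F G r : 1 < p -> 0 <= r < 1 ->
  disk_diff F -> disk_diff G ->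
  disk_diff (fun z => F z + G z)%C -> disk_diff (fun z => F z - G z)%C ->
  rpow (hardy_mean p (fun z => F z + G z)%C r) (upper_s p / p)
    + rpow (hardy_mean p (fun z => F z - G z)%C r) (upper_s p / p)
    <= 2 * (rpow (hardy_mean p F r) (upper_s p / p)
            + parallelogram_constant p * rpow (hardy_mean p G r) (upper_s p / p)).
Proof.
intros Hp Hr HF HG HS HD; unfold upper_s, parallelogram_constant.
destruct (Rle_dec p 2) as [H2|H2].
- replace (p / p) with 1 by (field; lra).
  rewrite !rpow_1, Rmult_1_l by (apply hardy_mean_nonneg; assumption || lra).
  apply clarkson_mean; assumption || lra.
- apply smoothness_mean; assumption || lra.
Qed.

(** * The weak parallelogram law for the Hardy norm *)

Definition in_hardy (p : R) (F : C -> C) : Prop :=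
  disk_diff F /\ is_finite (hardy_sup p F).

Lemma hardy_mean_le_sup p F r : is_finite (hardy_sup p F) -> 0 <= r < 1 ->
  hardy_mean p F r <= real (hardy_sup p F).
Proof.
intros Hfin Hr.
destruct (Lub_Rbar_correct (fun m => exists rho, 0 <= rho < 1 /\ m = hardy_mean p F rho))
  as [Hub _].
assert (H := Hub (hardy_mean p F r) (ex_intro _ r (conj Hr eq_refl))).
fold (hardy_sup p F) in H; rewrite <- Hfin in H; exact H.
Qed.

Lemma hardy_sup_le p F b :
  (forall r, 0 <= r < 1 -> hardy_mean p F r <= b) ->
  is_finite (hardy_sup p F) /\ real (hardy_sup p F) <= b.
Proof.
intros Hb.
destruct (Lub_Rbar_correct (fun m => exists rho, 0 <= rho < 1 /\ m = hardy_mean p F rho))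
  as [Hub Hleast].
fold (hardy_sup p F) in Hub, Hleast.
assert (H1 : Rbar_le (hardy_mean p F 0) (hardy_sup p F)).
{ apply Hub; exists 0; split; [lra|reflexivity]. }
assert (H2 : Rbar_le (hardy_sup p F) b).
{ apply Hleast; intros m (r & Hr & ->); apply Hb, Hr. }
destruct (hardy_sup p F); simpl in *; try contradiction.
split; [reflexivity|exact H2].
Qed.

Lemma hardy_sup_nonneg p F : 0 < p -> in_hardy p F -> 0 <= real (hardy_sup p F).
Proof.
intros Hp [HF Hfin].
apply Rle_trans with (hardy_mean p F 0); [apply hardy_mean_nonneg; auto; lra|].
apply hardy_mean_le_sup; [exact Hfin|lra].
Qed.

(** Because the means are nondecreasing in the radius, the supremum is their
    limit, which allows the radii of several functions to be chosen equal. *)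
Lemma hardy_sup_approached p F a b : 1 < p -> 0 < a -> in_hardy p F ->
  b < rpow (real (hardy_sup p F)) a ->
  exists r0, 0 <= r0 < 1 /\
    forall r, r0 <= r < 1 -> b < rpow (hardy_mean p F r) a.
Proof.
intros Hp Ha HF Hb; assert (HS := hardy_sup_nonneg p F ltac:(lra) HF).
destruct HF as [HF Hfin].
destruct (Rlt_le_dec b 0) as [Hneg|Hpos].
{ exists 0; split; [lra|]; intros r _.
  generalize (rpow_nonneg (hardy_mean p F r) a); lra. }
assert (Ha' : 0 <= / a) by (left; apply Rinv_0_lt_compat; exact Ha).
assert (Hex : exists r0, 0 <= r0 < 1 /\ rpow b (/ a) < hardy_mean p F r0).
{ apply NNPP; intros Hno.
  destruct (hardy_sup_le p F (rpow b (/ a))) as [_ Hle].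
  { intros r Hr; apply Rnot_lt_le; intros Hlt; apply Hno; exists r; auto. }
  apply (Rlt_irrefl b), Rlt_le_trans with (1 := Hb).
  rewrite <- (rpow_inv_l b a) by lra; apply rpow_le; lra. }
destruct Hex as (r0 & Hr0 & Hlt); exists r0; split; [exact Hr0|].
intros r Hr.
assert (Hmono := hardy_mean_nondecreasing p F r0 r ltac:(lra) HF ltac:(lra) ltac:(lra)).
apply Rnot_le_lt; intros Hle.
assert (Hinv := rpow_le _ _ (/ a) Ha' (conj (rpow_nonneg _ _) Hle)).
rewrite rpow_inv_r in Hinv; [lra|lra|].
apply hardy_mean_nonneg; auto; lra.
Qed.

Lemma upper_s_bounds p : 1 < p -> 1 < upper_s p.
Proof. intros Hp; unfold upper_s; destruct (Rle_dec p 2); lra. Qed.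

Lemma hardy_norm_power p F : 0 < p -> in_hardy p F ->
  rpow (hardy_norm p F) (upper_s p) = rpow (real (hardy_sup p F)) (upper_s p / p).
Proof.
intros Hp HF; unfold hardy_norm.
rewrite rpow_rpow by (apply hardy_sup_nonneg; assumption).
f_equal; field; lra.
Qed.

Lemma parallelogram_constant_pos p : 1 < p -> 0 < parallelogram_constant p.
Proof. intros Hp; unfold parallelogram_constant; destruct (Rle_dec p 2); lra. Qed.

Lemma weak_parallelogram p F G : 1 < p -> in_hardy p F -> in_hardy p G ->
  in_hardy p (fun z => F z + G z)%C -> in_hardy p (fun z => F z - G z)%C ->
  rpow (hardy_norm p (fun z => F z + G z)%C) (upper_s p)
    + rpow (hardy_norm p (fun z => F z - G z)%C) (upper_s p)
    <= 2 * (rpow (hardy_norm p F) (upper_s p)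
            + parallelogram_constant p * rpow (hardy_norm p G) (upper_s p)).
Proof.
intros Hp HF HG HS HD.
rewrite !hardy_norm_power by (assumption || lra).
assert (Ha : 0 < upper_s p / p).
{ generalize (upper_s_bounds p Hp); intros; apply Rdiv_lt_0_compat; lra. }
assert (HK := parallelogram_constant_pos p Hp).
apply le_epsilon; intros eps Heps.
destruct (hardy_sup_approached p _ _ (rpow (real (hardy_sup p (fun z => F z + G z)%C))
  (upper_s p / p) - eps / 2) Hp Ha HS) as (r1 & Hr1 & H1); [lra|].
destruct (hardy_sup_approached p _ _ (rpow (real (hardy_sup p (fun z => F z - G z)%C))
  (upper_s p / p) - eps / 2) Hp Ha HD) as (r2 & Hr2 & H2); [lra|].
set (r := Rmax r1 r2).
assert (Hr1' : r1 <= r) by apply Rmax_l; assert (Hr2' : r2 <= r) by apply Rmax_r.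
assert (Hr : 0 <= r < 1) by (split; [lra|apply Rmax_lub_lt; lra]).
specialize (H1 r ltac:(lra)); specialize (H2 r ltac:(lra)).
assert (W := weak_parallelogram_mean p F G r Hp Hr
  (proj1 HF) (proj1 HG) (proj1 HS) (proj1 HD)).
assert (Hle : forall U, in_hardy p U -> rpow (hardy_mean p U r) (upper_s p / p)
  <= rpow (real (hardy_sup p U)) (upper_s p / p)).
{ intros U HU; apply rpow_le; [lra|split].
  - apply hardy_mean_nonneg; [lra|apply HU|exact Hr].
  - apply hardy_mean_le_sup; [apply HU|exact Hr]. }
assert (LF := Hle F HF); assert (LG := Hle G HG).
apply (Rmult_le_compat_l (parallelogram_constant p)) in LG; lra.
Qed.

(** * The upper Pythagorean inequality *)

Lemma Rpower_2_gt_1 a : 0 < a -> 1 < Rpower 2 a.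
Proof.
intros Ha; assert (H : Rpower 2 0 < Rpower 2 a) by (apply Rpower_lt; lra).
rewrite Rpower_O in H; lra.
Qed.

(** Halving the increment: with [D t = phi t - phi 0] the hypothesis gives
    [D h <= 2 D (h / 2) + 2 K (h / 2) ^ s], hence
    [D 1 <= 2 ^ n D (2 ^ - n) + K (theta + ... + theta ^ n)] for
    [theta = 2 ^ (1 - s)]. The first term vanishes in the limit because
    [0 <= D] makes [D h <= D h + D (- h) <= 2 K h ^ s]. *)
Lemma smooth_minimum_bound (phi : R -> R) K s : 1 < s -> 0 <= K ->
  (forall t, phi 0 <= phi t) ->
  (forall m h, phi (m + h) + phi (m - h) <= 2 * (phi m + K * rpow (Rabs h) s)) ->
  phi 1 <= phi 0 + K / (Rpower 2 (s - 1) - 1).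
Proof.
intros Hs HK Hmin Hmid.
set (P := Rpower 2 (s - 1)).
assert (HP : 1 < P).
{ apply Rpower_2_gt_1; lra. }
set (theta := / P).
assert (Hth : 0 < theta < 1).
{ split; [apply Rinv_0_lt_compat; lra|].
  rewrite <- Rinv_1; apply Rinv_lt_contravar; lra. }
assert (Hhalf : 2 * rpow (/ 2) s = theta).
{ rewrite rpow_Rpower by lra; unfold theta, P.
  rewrite <- Rpower_Ropp; replace (- (s - 1)) with (1 + - s) by ring.
  rewrite Rpower_plus, Rpower_1 by lra; f_equal.
  unfold Rpower; rewrite ln_Rinv by lra; f_equal; ring. }
assert (Hpow : forall n, rpow ((/ 2) ^ n) s = rpow (/ 2) s ^ n).
{ induction n as [|n IH]; simpl; [apply rpow_1_l|].
  rewrite rpow_mult, IH by (try apply pow_le; lra); reflexivity. }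
assert (Hpos2 : forall n, 0 < (/ 2) ^ n) by (intros; apply pow_lt; lra).
assert (Hthn : forall n, 2 ^ n * rpow ((/ 2) ^ n) s = theta ^ n).
{ intros n; rewrite Hpow, <- Rpow_mult_distr, Hhalf; reflexivity. }
set (D := fun n => phi ((/ 2) ^ n) - phi 0).
assert (Hstep : forall n, D n <= 2 * D (S n) + 2 * K * rpow ((/ 2) ^ S n) s).
{ intros n; assert (H := Hmid ((/ 2) ^ S n) ((/ 2) ^ S n)).
  rewrite Rabs_pos_eq in H by (left; apply Hpos2).
  replace ((/ 2) ^ S n + (/ 2) ^ S n) with ((/ 2) ^ n) in H by (simpl; field).
  rewrite Rminus_eq_0 in H; unfold D; lra. }
assert (Hsum : forall n,
  D O <= 2 ^ n * D n + K * (1 - theta ^ n) / (P - 1)).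
{ induction n as [|n IH].
  - simpl; unfold Rdiv; rewrite Rminus_eq_0; lra.
  - apply Rle_trans with (1 := IH).
    assert (H := Rmult_le_compat_l (2 ^ n) _ _ (pow_le 2 n ltac:(lra)) (Hstep n)).
    assert (T := Hthn (S n)).
    replace (2 ^ n * (2 * D (S n) + 2 * K * rpow ((/ 2) ^ S n) s))
      with (2 ^ S n * D (S n) + K * (2 ^ S n * rpow ((/ 2) ^ S n) s)) in H
      by (simpl; ring).
    rewrite T in H.
    replace (K * (1 - theta ^ S n) / (P - 1))
      with (K * (1 - theta ^ n) / (P - 1) + K * theta ^ S n); [lra|].
    replace (theta ^ n) with (theta ^ S n * P) by (simpl; unfold theta; field; lra).
    field; lra. }
assert (Hrem : forall n, 2 ^ n * D n <= 2 * K * theta ^ n).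
{ intros n; assert (H := Hmid 0 ((/ 2) ^ n)).
  rewrite Rabs_pos_eq, Rplus_0_l in H by (left; apply Hpos2).
  assert (Hm := Hmin (0 - (/ 2) ^ n)).
  rewrite <- (Hthn n).
  assert (H2 : D n <= 2 * K * rpow ((/ 2) ^ n) s) by (unfold D; lra).
  apply (Rmult_le_compat_l (2 ^ n)) in H2; [lra|apply pow_le; lra]. }
assert (HD0 : D O = phi 1 - phi 0) by reflexivity.
apply le_epsilon; intros eps Heps.
destruct (pow_lt_1_zero theta) with (y := eps / (2 * K + 1)) as [N HN].
{ rewrite Rabs_pos_eq; lra. }
{ apply Rdiv_lt_0_compat; lra. }
specialize (HN N (le_n N)); rewrite Rabs_pos_eq in HN by (apply pow_le; lra).
assert (Htn : 0 < theta ^ N) by (apply pow_lt; lra).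
apply (Rmult_lt_compat_l (2 * K + 1)) in HN; [|lra].
replace ((2 * K + 1) * (eps / (2 * K + 1))) with eps in HN by (field; lra).
assert (HS := Hsum N); assert (HR := Hrem N).
assert (Hlast : K * (1 - theta ^ N) / (P - 1) <= K / (P - 1)).
{ apply Rmult_le_compat_r; [left; apply Rinv_0_lt_compat; lra|nra]. }
lra.
Qed.

Lemma upper_K2_parallelogram p : 1 < p ->
  upper_K2 p = parallelogram_constant p / (Rpower 2 (upper_s p - 1) - 1).
Proof.
intros Hp; unfold upper_K2, parallelogram_constant, upper_s.
destruct (Rle_dec p 2); [reflexivity|].
replace (2 - 1) with 1 by ring; rewrite Rpower_1 by lra; field.
Qed.

Lemma upper_K2_pos p : 1 < p -> 0 < upper_K2 p.
Proof.
intros Hp; rewrite upper_K2_parallelogram by exact Hp.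
apply Rdiv_lt_0_compat; [apply parallelogram_constant_pos, Hp|].
assert (1 < Rpower 2 (upper_s p - 1)); [|lra].
apply Rpower_2_gt_1; generalize (upper_s_bounds p Hp); lra.
Qed.

Lemma in_hardy_affine p f (a b : C) : 1 < p -> in_hardy p f ->
  in_hardy p (fun z => a + b * f z)%C.
Proof.
intros Hp [Hf Hfin].
assert (HF : disk_diff (fun z => a + b * f z)%C).
{ intros z Hz; destruct (complex_diff_scale b f z (Hf z Hz)) as [B HB].
  exists B; intros eps Heps; destruct (HB eps Heps) as (delta & Hd & H).
  exists delta; split; [exact Hd|]; intros w Hw.
  replace (a + b * f w - (a + b * f z) - B * (w - z))%C
    with (b * f w - b * f z - B * (w - z))%C by ring.
  apply H, Hw. }
split; [exact HF|].
apply (hardy_sup_le p (fun z => a + b * f z)%C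
  (rpow 2 p * rpow (Cmod a) p + rpow 2 p * rpow (Cmod b) p * real (hardy_sup p f))).
intros r Hr.
assert (Hm := hardy_mean_le_sup p f r Hfin Hr).
assert (Hm0 := hardy_mean_nonneg p f r ltac:(lra) Hf Hr).
assert (HG := hardy_mean_nonneg p _ r ltac:(lra) HF Hr).
assert (Hlin : hardy_mean p (fun z => a + b * f z)%C r
  + hardy_mean p (fun z => a + b * f z)%C r
  <= (rpow 2 p * rpow (Cmod b) p) * hardy_mean p f r + 0 * hardy_mean p f r
     + rpow 2 p * rpow (Cmod a) p).
{ apply hardy_mean_linear_le; try assumption; [lra|].
  intros z _.
  assert (T := Cmod_triangle a (b * f z)%C); rewrite Cmod_mult in T.
  set (x := Cmod a) in *; set (y := Cmod b * Cmod (f z)) in *.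
  assert (Hx : 0 <= x) by apply Cmod_ge_0.
  assert (Hy : 0 <= y) by (apply Rmult_le_pos; apply Cmod_ge_0).
  assert (H1 : rpow (Cmod (a + b * f z)%C) p <= rpow (2 * ((x + y) / 2)) p).
  { apply rpow_le; [lra|split; [apply Cmod_ge_0|lra]]. }
  rewrite rpow_mult in H1 by lra.
  assert (H2 := rpow_midpoint_convex x y p ltac:(lra) Hx Hy).
  apply (Rmult_le_compat_l (rpow 2 p)) in H2; [|apply rpow_nonneg].
  unfold y in H2 at 2; rewrite rpow_mult in H2 by apply Cmod_ge_0; lra. }
assert (0 <= rpow 2 p * rpow (Cmod b) p) by (apply Rmult_le_pos; apply rpow_nonneg).
nra.
Qed.

Lemma hardy_norm_ext p F G : (forall z, Cmod (F z) = Cmod (G z)) ->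
  hardy_norm p F = hardy_norm p G.
Proof.
intros E.
assert (Em : forall r, hardy_mean p F r = hardy_mean p G r).
{ intros r; unfold hardy_mean; f_equal; apply RInt_ext.
  intros t _; rewrite E; reflexivity. }
unfold hardy_norm, hardy_sup; do 2 f_equal; apply Lub_Rbar_eqset; intros m.
split; intros (r & Hr & ->); exists r; rewrite Em; auto.
Qed.

Lemma hardy_norm_nonneg p F : 0 <= hardy_norm p F.
Proof. apply rpow_nonneg. Qed.

Lemma hardy_norm_scale_le p f (b : C) : 1 < p -> in_hardy p f ->
  in_hardy p (fun z => b * f z)%C /\
  rpow (hardy_norm p (fun z => b * f z)%C) (upper_s p)
    <= rpow (Cmod b) (upper_s p) * rpow (hardy_norm p f) (upper_s p).
Proof.
intros Hp Hf; assert (Hs := upper_s_bounds p Hp).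
assert (HG : disk_diff (fun z => b * f z)%C).
{ intros z Hz; apply complex_diff_scale, Hf, Hz. }
assert (HS := hardy_sup_nonneg p f ltac:(lra) Hf).
destruct (hardy_sup_le p (fun z => b * f z)%C (rpow (Cmod b) p * real (hardy_sup p f)))
  as [Hfin Hle].
{ intros r Hr.
  assert (Hm := hardy_mean_le_sup p f r (proj2 Hf) Hr).
  assert (Hlin : hardy_mean p (fun z => b * f z)%C r
      + hardy_mean p (fun z => b * f z)%C r
    <= (2 * rpow (Cmod b) p) * hardy_mean p f r + 0 * hardy_mean p f r + 0).
  { apply hardy_mean_linear_le; try assumption; try apply Hf; [lra|].
    intros z _; rewrite Cmod_mult, rpow_mult by apply Cmod_ge_0; lra. }
  generalize (rpow_nonneg (Cmod b) p); nra. }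
assert (HbG : in_hardy p (fun z => b * f z)%C) by (split; assumption).
split; [exact HbG|].
rewrite !hardy_norm_power by (assumption || lra).
replace (rpow (Cmod b) (upper_s p)) with (rpow (rpow (Cmod b) p) (upper_s p / p)).
2: { rewrite rpow_rpow by apply Cmod_ge_0; f_equal; field; lra. }
rewrite <- rpow_mult by (assumption || apply rpow_nonneg).
apply rpow_le; [apply Rdiv_le_0_compat; lra|].
split; [apply hardy_sup_nonneg; [lra|exact HbG]|exact Hle].
Qed.

Lemma hardy_norm_one p F : 0 < p -> (forall z, F z = RtoC 1) -> hardy_norm p F = 1.
Proof.
intros Hp HF.
assert (HPI := PI_RGT_0).
assert (Em : forall r, hardy_mean p F r = 1).
{ intros r; unfold hardy_mean.
  rewrite (RInt_ext _ (fun _ => 1)).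
  - rewrite RInt_Rconst; field; lra.
  - intros t _; rewrite HF, Cmod_1; apply rpow_1_l. }
destruct (hardy_sup_le p F 1) as [Hfin Hle]; [intros r _; rewrite Em; lra|].
assert (Hge := hardy_mean_le_sup p F 0 Hfin ltac:(lra)); rewrite Em in Hge.
unfold hardy_norm; replace (real (hardy_sup p F)) with 1 by lra; apply rpow_1_l.
Qed.

Lemma hardy_norm_pos p f : 1 < p -> in_hardy p f -> f (RtoC 0) <> RtoC 0 ->
  0 < hardy_norm p f.
Proof.
intros Hp Hf H0; assert (HPI := PI_RGT_0); apply rpow_pos.
apply Rlt_le_trans with (2 := hardy_mean_le_sup p f 0 (proj2 Hf) ltac:(lra)).
unfold hardy_mean.
rewrite (RInt_ext _ (fun _ => rpow (Cmod (f (RtoC 0))) p)).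
- rewrite RInt_Rconst.
  assert (H : 0 < rpow (Cmod (f (RtoC 0))) p) by (apply rpow_pos, Cmod_gt_0, H0).
  replace (/ (2 * PI) * ((2 * PI - 0) * rpow (Cmod (f (RtoC 0))) p))
    with (rpow (Cmod (f (RtoC 0))) p) by (field; lra); exact H.
- intros t _; unfold polar; rewrite !Rmult_0_l; reflexivity.
Qed.

(** The upper Pythagorean inequality for the decomposition of [1] into
    [1 - lambda f] and [lambda f]. The optimality of [lambda] says that
    [1 - lambda f + t lambda f] has its least norm at [t = 0], and its value at
    [t = 1] is [1]. *)
Lemma pythagorean_opa p f (lambda : C) : 1 < p -> in_hardy p f ->
  (forall r : C, hardy_norm p (fun z => 1 - lambda * f z)%C
                 <= hardy_norm p (fun z => 1 - r * f z)%C) ->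
  1 <= rpow (hardy_norm p (fun z => 1 - lambda * f z)%C) (upper_s p)
       + upper_K2 p * (rpow (Cmod lambda) (upper_s p)
                       * rpow (hardy_norm p f) (upper_s p)).
Proof.
intros Hp Hf Hopt; assert (Hs := upper_s_bounds p Hp).
set (x := fun (t : R) (z : C) => (1 - (RtoC (1 - t) * lambda) * f z)%C).
set (phi := fun t => rpow (hardy_norm p (x t)) (upper_s p)).
set (Y := rpow (Cmod lambda) (upper_s p) * rpow (hardy_norm p f) (upper_s p)).
assert (HY : 0 <= Y) by (apply Rmult_le_pos; apply rpow_nonneg).
assert (HK := parallelogram_constant_pos p Hp).
assert (Hx : forall t, in_hardy p (x t)).
{ intros t; replace (x t) with (fun z => 1 + (- (RtoC (1 - t) * lambda)) * f z)%C.
  - apply in_hardy_affine; assumption.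
  - apply functional_extensionality; intros z; unfold x; ring. }
assert (Hx0 : hardy_norm p (x 0) = hardy_norm p (fun z => 1 - lambda * f z)%C).
{ apply hardy_norm_ext; intros z; unfold x; f_equal; rewrite Rminus_0_r; ring. }
assert (B := smooth_minimum_bound phi (parallelogram_constant p * Y) (upper_s p) Hs
  ltac:(apply Rmult_le_pos; lra)).
assert (E1 : phi 1 = 1).
{ unfold phi; rewrite hardy_norm_one; [apply rpow_1_l|lra|].
  intros z; unfold x; rewrite Rminus_eq_0; ring. }
assert (E0 : phi 0 = rpow (hardy_norm p (fun z => 1 - lambda * f z)%C) (upper_s p))
  by (unfold phi; rewrite Hx0; reflexivity).
rewrite E1, E0 in B.
replace (upper_K2 p * Y)
  with (parallelogram_constant p * Y / (Rpower 2 (upper_s p - 1) - 1)).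
2: { rewrite upper_K2_parallelogram by exact Hp; unfold Rdiv; ring. }
apply B.
- intros t; rewrite <- E0; unfold phi; apply rpow_le; [lra|].
  split; [apply hardy_norm_nonneg|rewrite Hx0; apply Hopt].
- intros m h.
  set (y := fun z => (RtoC h * lambda * f z)%C).
  destruct (hardy_norm_scale_le p f (RtoC h * lambda)%C Hp Hf) as [Hy Hyle].
  fold y in Hy, Hyle.
  assert (Ep : (fun z => x m z + y z)%C = x (m + h)).
  { apply functional_extensionality; intros z; unfold x, y.
    rewrite !RtoC_minus, RtoC_plus; ring. }
  assert (Em : (fun z => x m z - y z)%C = x (m - h)).
  { apply functional_extensionality; intros z; unfold x, y.
    rewrite !RtoC_minus; ring. }
  assert (W := weak_parallelogram p (x m) y Hp (Hx m) Hy).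
  rewrite Ep, Em in W; specialize (W (Hx _) (Hx _)).
  rewrite Cmod_mult, Cmod_R, rpow_mult in Hyle
    by (apply Rabs_pos || apply Cmod_ge_0).
  apply (Rmult_le_compat_l (parallelogram_constant p)) in Hyle; [|lra].
  unfold phi, Y; lra.
Qed.

Theorem proposition3p9 :
  forall (p : R) (f : C -> C) (lambda : C),
    1 < p ->
    Hp p f ->
    f (RtoC 0) <> RtoC 0 ->
    is_opa 0 p f (fun _ : C => lambda) ->
    forall c : C,
      rpow (Cmod lambda) (upper_s p) >=
      (1 - rpow (hardy_norm p (fun z => (c * f z - 1)%C)) (upper_s p)) /
      (upper_K2 p *
        (rpow (hardy_norm p (fun z => (f z - f (RtoC 0))%C)) (upper_s p)
         + rpow (hardy_norm p f) (upper_s p))).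
Proof.
intros p f lambda Hp1 [Hhol Hfin] Hf0 [_ Hopt] c.
assert (Hf : in_hardy p f).
{ split; [exact (holomorphic_disk_diff f Hhol)|exact Hfin]. }
assert (Hconst : forall r : C, hardy_norm p (fun z => 1 - lambda * f z)%C
  <= hardy_norm p (fun z => 1 - r * f z)%C).
{ intros r; apply (Hopt (fun _ => r)); exists (fun _ => r); intros z.
  rewrite sum_O; simpl; ring. }
assert (Hs := upper_s_bounds p Hp1); assert (HK := upper_K2_pos p Hp1).
assert (Hpyth := pythagorean_opa p f lambda Hp1 Hf Hconst).
assert (Hc : rpow (hardy_norm p (fun z => 1 - lambda * f z)%C) (upper_s p)
  <= rpow (hardy_norm p (fun z => (c * f z - 1)%C)) (upper_s p)).
{ apply rpow_le; [lra|split; [apply hardy_norm_nonneg|]].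
  rewrite (hardy_norm_ext p (fun z => (c * f z - 1)%C) (fun z => (1 - c * f z)%C)).
  - apply Hconst.
  - intros z; rewrite <- Cmod_opp; f_equal; ring. }
assert (HY : 0 < rpow (hardy_norm p f) (upper_s p))
  by (apply rpow_pos, hardy_norm_pos; assumption).
assert (HZ := rpow_nonneg (hardy_norm p (fun z => (f z - f (RtoC 0))%C)) (upper_s p)).
assert (HL := rpow_nonneg (Cmod lambda) (upper_s p)).
set (L := rpow (Cmod lambda) (upper_s p)) in *.
set (Y := rpow (hardy_norm p f) (upper_s p)) in *.
set (Z := rpow (hardy_norm p (fun z => (f z - f (RtoC 0))%C)) (upper_s p)) in *.
assert (HKZ : 0 < upper_K2 p * (Z + Y)) by (apply Rmult_lt_0_compat; lra).
apply Rle_ge, Rmult_le_reg_r with (1 := HKZ).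
unfold Rdiv; rewrite Rmult_assoc, Rinv_l, Rmult_1_r by lra.
assert (0 <= upper_K2 p * (L * Z)).
{ apply Rmult_le_pos; [lra|apply Rmult_le_pos; assumption]. }
lra.
Qed.
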